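(* Let $R$ be a Dedekind ring with field of fractions $K$, let $1\le e<d$ be integers invertible in $R$, and let $f,g\in R[x]$ be monic polynomials with $\deg(f)=d$ and $\deg(g)=e$. Let $\widehat{\mathscr{P}}$ be the formal neighbourhood of infinity in the path space of the correspondence $g(y)=f(x)$, with shift map $\sigma:\widehat{\mathscr{P}}\to\widehat{\mathscr{P}}$, and let $\widehat{\mathscr{B}}$ be the formal neighbourhood of infinity in the path space of the correspondence $y^e=x^d$, with shift map $\tau:\widehat{\mathscr{B}}\to\widehat{\mathscr{B}}$. Then there is an isomorphism $\Xi:\widehat{\mathscr{P}}\to\widehat{\mathscr{B}}$ of $K$-schemes such that $\Xi\circ\sigma=\tau\circ\Xi$.
   Context: The path space $\mathscr{P}$ of the correspondence $C:g(y)=f(x)$ is the scheme parametrizing infinite forward paths $(x_0,x_1,x_2,\dots)$ in $\mathbb{P}^1$, with homogeneous coordinates $[x_{i,0}:x_{i,1}]$ for $x_i=x_{i,1}/x_{i,0}$, subject to the equations $$x_{i+1,0}^{e}\,x_{i,0}^{d}\bigl(g(x_{i+1,1}/x_{i+1,0})-f(x_{i,1}/x_{i,0})\bigr)=0\qquad(i\ge 0).$$ The map $\pi:\mathscr{P}\to\mathbb{P}^1$ sends a path to $x_0$, and the shift $\sigma:\mathscr{P}\to\mathscr{P}$ sends $(x_0,x_1,\dots)$ to $(x_1,x_2,\dots)$. There is a unique point of $\mathscr{P}$ above $\infty\in\mathbb{P}^1$, namely $(\infty,\infty,\dots)$, and $w_i=x_{i,0}/x_{i,1}=1/x_i$ are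 local coordinates there. The completed local ring $\mathcal{O}_{\mathscr{P},\infty}$ at this point is the following. For $n\ge 0$ let $$S_n=K[[w_0,\dots,w_n]]/\bigl(w_{i+1}^{e}w_i^{d}(g(w_{i+1}^{-1})-f(w_i^{-1})):0\le i<n\bigr).$$ Give $w_i$ weight $(d/e)^i$, so that $w_0$ has weight $1$ and there are only finitely many monomials of weight below any given bound. For $X>0$ let $\mathfrak{m}_{n,X}\subseteq S_n$ be the ideal of classes of power series all of whose monomials have weight $>X$. Then $\mathcal{O}_{\mathscr{P},\infty}$ is the completion of $\varinjlim S_n$ with respect to the filtration by the ideals $\bigcup_n\mathfrak{m}_{n,X}$, $X\to\infty$. Set $\widehat{\mathscr{P}}=\operatorname{Spec}(\mathcal{O}_{\mathscr{P},\infty})$. The endomorphism $\sigma$ of $\widehat{\mathscr{P}}$ is the one induced by the continuous $K$-algebra endomorphism $w_i\mapsto w_{i+1}$. In the special case $g(y)=y^e$, $f(x)=x^d$, the path space is denoted $\mathscr{B}$, the corresponding formal scheme $\widehat{\mathscr{B}}=\operatorname{Spec}(\mathcal{O}_{\mathscr{B},\infty})$, and the shift $\tau$; writing $z_i$ for the coordinates in this case, the relations are $z_{i+1}^e=z_i^d$ and $\tau$ is induced by $z_i\mapsto z_{i+1}$. *)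

(* Defs.v *)
From HB Require Import structures.
From mathcomp Require Import all_boot all_order all_algebra interval_inference.
From mathcomp Require Import boolp.
From mathcomp.multinomials Require Import mpoly.

Set Implicit Arguments.
Unset Strict Implicit.
Unset Printing Implicit Defensive.

Import Order.TTheory GRing.Theory Num.Theory.

Local Open Scope ring_scope.
Local Open Scope quotient_scope.

Record ideal (A : comPzRingType) := Ideal {
  ideal_mem :> A -> Prop;
  ideal0 : ideal_mem 0;
  idealD : forall x y, ideal_mem x -> ideal_mem y -> ideal_mem (x + y);
  idealM : forall a x, ideal_mem x -> ideal_mem (a * x)
}.

Section IdealSpan.
Variables (A : comPzRingType) (n : nat) (r : 'I_n -> A).

Definition in_span (x : A) := exists c : 'I_n -> A, x = \sum_i c i * r i.

Lemma in_span0 : in_span 0.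
Proof.
by exists (fun=> 0); rewrite big1 // => i _; rewrite mul0r.
Qed.

Lemma in_spanD x y : in_span x -> in_span y -> in_span (x + y).
Proof.
move=> [c ->] [c' ->]; exists (fun i => c i + c' i).
by rewrite -big_split; apply: eq_bigr => i _; rewrite mulrDl.
Qed.

Lemma in_spanM a x : in_span x -> in_span (a * x).
Proof.
move=> [c ->]; exists (fun i => a * c i).
by rewrite mulr_sumr; apply: eq_bigr => i _; rewrite mulrA.
Qed.

Definition ideal_span : ideal A := Ideal in_span0 in_spanD in_spanM.

End IdealSpan.

(* Fields count as Dedekind rings. *)
Section Dedekind.
Variable R : idomainType.

Definition noetherian :=
  forall I : ideal R, exists n (r : 'I_n -> R), forall x, I x <-> ideal_span r x.

Definition integrally_closed :=
  forall x : {fraction R},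
    integralOver (@tofrac R) x -> exists a : R, x = tofrac a.

Definition prime_ideal (P : ideal R) :=
  ~ P 1 /\ forall x y, P (x * y) -> P x \/ P y.

Definition maximal_ideal (M : ideal R) :=
  ~ M 1 /\
  forall I : ideal R, (forall x, M x -> I x) -> ~ I 1 -> forall x, I x -> M x.

Definition dedekind_ring :=
  [/\ noetherian, integrally_closed
    & forall P : ideal R,
        prime_ideal P -> (exists2 x, P x & x != 0) -> maximal_ideal P].

End Dedekind.

Section QuotientRing.
Variables (A : comPzRingType) (I : ideal A).

Definition ideal_pred : A -> bool := fun x => `[< I x >].

Lemma ideal_predP x : reflect (I x) (x \in ideal_pred).
Proof. exact: asboolP. Qed.

Lemma ideal_pred_zmod_closed : zmod_closed ideal_pred.
Proof.
split=> [|x y /ideal_predP Ix /ideal_predP Iy]; apply/ideal_predP.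
  exact: ideal0.
by apply: idealD => //; rewrite -mulN1r; apply: idealM.
Qed.

HB.instance Definition _ :=
  GRing.isZmodClosed.Build A ideal_pred ideal_pred_zmod_closed.

Definition quotr := Quotient.quot (GRing.ZmodClosed.clone A ideal_pred _).

HB.instance Definition _ := GRing.Zmodule.on quotr.

Definition qproj (x : A) : quotr := \pi_quotr x.

Lemma qproj_eq x y : I (x - y) -> qproj x = qproj y.
Proof.
by move=> Ixy; apply/eqP; rewrite -Quotient.idealrBE; apply/ideal_predP.
Qed.

Lemma qproj_inj x y : qproj x = qproj y -> I (x - y).
Proof.
by move/eqP; rewrite -Quotient.idealrBE => /ideal_predP.
Qed.

Lemma qproj_surj (a : quotr) : exists x, a = qproj x.
Proof. by exists (repr a); rewrite /qproj reprK. Qed.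

Lemma qproj_is_zmod_morphism : zmod_morphism qproj.
Proof. by move=> x y; rewrite /qproj /quotr !piE. Qed.

Definition qone : quotr := qproj 1.
Definition qmul (a b : quotr) : quotr := qproj (repr a * repr b).

Lemma qprojM x y : qproj (x * y) = qmul (qproj x) (qproj y).
Proof.
apply: qproj_eq.
have rI z : I (z - repr (qproj z)) by apply: qproj_inj; rewrite /qproj reprK.
set x' := repr _; set y' := repr _.
have -> : x * y - x' * y' = y * (x - x') + x' * (y - y').
  by rewrite !mulrBr [y * x]mulrC [y * x']mulrC subrKA.
by apply: idealD; apply: idealM; apply: rI.
Qed.

Lemma qmulA : associative qmul.
Proof.
move=> a b c; have [x ->] := qproj_surj a.
have [y ->] := qproj_surj b; have [z ->] := qproj_surj c.
by rewrite -!qprojM mulrA.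
Qed.

Lemma qmulC : commutative qmul.
Proof. by move=> a b; rewrite /qmul mulrC. Qed.

Lemma qmul1 : left_id qone qmul.
Proof.
by move=> a; have [x ->] := qproj_surj a; rewrite -qprojM mul1r.
Qed.

Lemma qmulDl : left_distributive qmul +%R.
Proof.
have qD x y : qproj x + qproj y = qproj (x + y).
  by rewrite /qproj /quotr !piE.
move=> a b c; have [x ->] := qproj_surj a.
have [y ->] := qproj_surj b; have [z ->] := qproj_surj c.
by rewrite qD -!qprojM mulrDl qD.
Qed.

HB.instance Definition _ :=
  GRing.Zmodule_isComPzRing.Build quotr qmulA qmulC qmul1 qmulDl.

Lemma qproj_is_monoid_morphism : monoid_morphism qproj.
Proof. by split=> // x y; rewrite qprojM. Qed.

HB.instance Definition _ :=
  GRing.isZmodMorphism.Build A quotr qproj qproj_is_zmod_morphism.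
HB.instance Definition _ :=
  GRing.isMonoidMorphism.Build A quotr qproj qproj_is_monoid_morphism.

End QuotientRing.

Section QuotientLift.
Variables (A B : comPzRingType) (I : ideal A) (f : {rmorphism A -> B}).
Hypothesis fI : forall x, I x -> f x = 0.

Definition qlift_fun & (forall x, I x -> f x = 0) := fun a : quotr I => f (repr a).
Local Notation qlift := (qlift_fun fI).

Lemma qlift_proj x : qlift (qproj I x) = f x.
Proof.
apply/eqP; rewrite -subr_eq0 -rmorphB fI //; apply: qproj_inj.
by rewrite /qproj reprK.
Qed.

Lemma qlift_is_zmod_morphism : zmod_morphism qlift.
Proof.
move=> a b; have [x ->] := qproj_surj a; have [y ->] := qproj_surj b.
by rewrite -rmorphB !qlift_proj rmorphB.
Qed.

Lemma qlift_is_monoid_morphism : monoid_morphism qlift.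
Proof.
split=> [|a b]; first by rewrite -(rmorph1 (qproj I)) qlift_proj rmorph1.
have [x ->] := qproj_surj a; have [y ->] := qproj_surj b.
by rewrite -rmorphM !qlift_proj rmorphM.
Qed.

HB.instance Definition _ :=
  GRing.isZmodMorphism.Build (quotr I) B (qlift_fun fI) qlift_is_zmod_morphism.
HB.instance Definition _ :=
  GRing.isMonoidMorphism.Build (quotr I) B (qlift_fun fI) qlift_is_monoid_morphism.

End QuotientLift.

Section ProductRing.
Variables (J : Type) (A : J -> comPzRingType).

Definition dprod := forall j, A j.

HB.instance Definition _ := gen_eqMixin dprod.
HB.instance Definition _ := gen_choiceMixin dprod.

Definition dprod_zero : dprod := fun j => 0.
Definition dprod_opp (x : dprod) : dprod := fun j => - x j.
Definition dprod_add (x y : dprod) : dprod := fun j => x j + y j.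
Definition dprod_one : dprod := fun j => 1.
Definition dprod_mul (x y : dprod) : dprod := fun j => x j * y j.

Lemma dprod_addA : associative dprod_add.
Proof. by move=> x y z; apply: functional_extensionality_dep => j; apply: addrA. Qed.
Lemma dprod_addC : commutative dprod_add.
Proof. by move=> x y; apply: functional_extensionality_dep => j; apply: addrC. Qed.
Lemma dprod_add0 : left_id dprod_zero dprod_add.
Proof. by move=> x; apply: functional_extensionality_dep => j; apply: add0r. Qed.
Lemma dprod_addN : left_inverse dprod_zero dprod_opp dprod_add.
Proof. by move=> x; apply: functional_extensionality_dep => j; apply: addNr. Qed.

HB.instance Definition _ :=
  GRing.isZmodule.Build dprod dprod_addA dprod_addC dprod_add0 dprod_addN.

Lemma dprod_mulA : associative dprod_mul.
Proof. by move=> x y z; apply: functional_extensionality_dep => j; apply: mulrA. Qed.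
Lemma dprod_mulC : commutative dprod_mul.
Proof. by move=> x y; apply: functional_extensionality_dep => j; apply: mulrC. Qed.
Lemma dprod_mul1 : left_id dprod_one dprod_mul.
Proof. by move=> x; apply: functional_extensionality_dep => j; apply: mul1r. Qed.
Lemma dprod_mulDl : left_distributive dprod_mul dprod_add.
Proof. by move=> x y z; apply: functional_extensionality_dep => j; apply: mulrDl. Qed.

HB.instance Definition _ := GRing.Zmodule_isComPzRing.Build dprod
  dprod_mulA dprod_mulC dprod_mul1 dprod_mulDl.

End ProductRing.

(* Commutative K-algebras, the zero algebra included: a commutative ring with  *)
(* a ring morphism from K.  (comAlgType excludes the zero ring.)               *)
Record kalg (K : fieldType) := KAlg {
  kalg_ring :> comPzRingType;
  kscal : {rmorphism K -> kalg_ring}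
}.
Arguments kscal {K} A : rename.

Record khom (K : fieldType) (A B : kalg K) := KHom {
  khom_fun :> {rmorphism A -> B};
  khom_scal : forall a, khom_fun (kscal A a) = kscal B a
}.

Section KHom.
Variable K : fieldType.
Implicit Types A B C : kalg K.

Lemma khom_ext A B (f g : khom A B) : f =1 g -> f = g.
Proof.
case: f => [[f [[af] [mf]]] sf]; case: g => [[g [[ag] [mg]]] sg] /= fg.
have {}fg : f = g by apply: functional_extensionality_dep.
subst g; rewrite (Prop_irrelevance ag af) (Prop_irrelevance mg mf) in sg *.
by rewrite (Prop_irrelevance sg sf).
Qed.

Definition khom_id A : khom A A := @KHom K A A idfun (fun=> erefl).

Lemma khom_comp_scal A B C (g : khom B C) (f : khom A B) a :
  (g \o f) (kscal A a) = kscal C a.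
Proof. by rewrite /= !khom_scal. Qed.

Definition khom_comp A B C (g : khom B C) (f : khom A B) : khom A C :=
  @KHom K A C (g \o f) (khom_comp_scal g f).

End KHom.

(* K-schemes through their functors of points: a K-functor is a functor from   *)
(* commutative K-algebras to sets, a morphism is a natural transformation, and *)
(* Spec A is the functor T |-> Hom_K(A, T) of T-points.                        *)
Record kfunctor (K : fieldType) := KFunctor {
  points :> kalg K -> Type;
  points_map : forall T T', khom T T' -> points T -> points T';
  points_map_id : forall T x, points_map (khom_id T) x = x;
  points_map_comp : forall T T' T'' (h' : khom T' T'') (h : khom T T') x,
    points_map (khom_comp h' h) x = points_map h' (points_map h x)
}.

Record kmor (K : fieldType) (X Y : kfunctor K) := KMor {
  on_points :> forall T, X T -> Y T;
  on_points_nat : forall T T' (h : khom T T') x,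
    on_points (points_map h x) = points_map h (on_points x)
}.

Section KMor.
Variable K : fieldType.
Implicit Types X Y Z : kfunctor K.

Lemma kmor_ext X Y (u v : kmor X Y) : (forall T x, u T x = v T x) -> u = v.
Proof.
case: u => u nu; case: v => v nv /= uv.
have {}uv : u = v.
  by apply: functional_extensionality_dep => T;
     apply: functional_extensionality_dep => x.
by subst v; rewrite (Prop_irrelevance nv nu).
Qed.

Definition kmor_id X : kmor X X :=
  @KMor K X X (fun T x => x) (fun T T' h x => erefl).

Lemma kmor_comp_nat X Y Z (v : kmor Y Z) (u : kmor X Y) T T' (h : khom T T') x :
  v T' (u T' (points_map h x)) = points_map h (v T (u T x)).
Proof. by rewrite !on_points_nat. Qed.

Definition kmor_comp X Y Z (v : kmor Y Z) (u : kmor X Y) : kmor X Z :=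
  @KMor K X Z (fun T x => v T (u T x)) (kmor_comp_nat v u).

Definition kmor_iso X Y (u : kmor X Y) :=
  exists v : kmor Y X, kmor_comp v u = kmor_id X /\ kmor_comp u v = kmor_id Y.

Definition Spec (A : kalg K) : kfunctor K.
Proof.
refine (@KFunctor K (fun T => khom A T) (fun T T' h x => khom_comp h x) _ _).
- by move=> T x; apply: khom_ext.
- by move=> T T' T'' h' h x; apply: khom_ext.
Defined.

Definition Spec_map (A B : kalg K) (f : khom A B) : kmor (Spec B) (Spec A).
Proof.
refine (@KMor K (Spec B) (Spec A) (fun T x => khom_comp x f) _).
by move=> T T' h x; apply: khom_ext.
Defined.

End KMor.

Section KQuotient.
Variables (K : fieldType) (A : kalg K) (I : ideal A).

Definition kquot : kalg K := @KAlg K (quotr I) (qproj I \o kscal A).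

Definition kproj : khom A kquot := @KHom K A kquot (qproj I) (fun=> erefl).

Variables (B : kalg K) (f : khom A B).
Hypothesis fI : forall x, I x -> f x = 0.

Definition klift : khom kquot B :=
  @KHom K kquot B (qlift_fun fI)
    (fun a => etrans (qlift_proj fI (kscal A a)) (khom_scal f a)).

End KQuotient.

Section KQuotientMap.
Variables (K : fieldType) (A B : kalg K) (I : ideal A) (J : ideal B).
Variables (f : khom A B) (fIJ : forall x, I x -> J (f x)).

Lemma kquot_map_subproof x : I x -> khom_comp (kproj J) f x = 0.
Proof.
move=> Ix; rewrite -(rmorph0 (kproj J)); apply: qproj_eq.
by rewrite subr0; apply: fIJ.
Qed.

Definition kquot_map : khom (kquot I) (kquot J) := klift kquot_map_subproof.

Lemma kquot_mapE x : kquot_map (kproj I x) = kproj J (f x).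
Proof. exact: qlift_proj. Qed.

End KQuotientMap.

Section KProduct.
Variables (K : fieldType) (J : Type) (A : J -> kalg K).

Definition kprod_scal (a : K) : dprod (fun j => A j : comPzRingType) :=
  fun j => kscal (A j) a.

Lemma kprod_scal_zmod : zmod_morphism kprod_scal.
Proof.
move=> a b; apply: functional_extensionality_dep => j.
by rewrite /kprod_scal rmorphB.
Qed.

Lemma kprod_scal_monoid : monoid_morphism kprod_scal.
Proof.
by split=> [|a b]; apply: functional_extensionality_dep => j;
  rewrite /kprod_scal ?rmorph1 ?rmorphM.
Qed.

HB.instance Definition _ := GRing.isZmodMorphism.Build K _ _ kprod_scal_zmod.
HB.instance Definition _ :=
  GRing.isMonoidMorphism.Build K _ _ kprod_scal_monoid.

Definition kprod : kalg K := KAlg kprod_scal.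

End KProduct.

Record subalgebra (K : fieldType) (A : kalg K) := Subalgebra {
  subalg_mem :> A -> Prop;
  subalg_scal : forall a, subalg_mem (kscal A a);
  subalgB : forall x y, subalg_mem x -> subalg_mem y -> subalg_mem (x - y);
  subalgM : forall x y, subalg_mem x -> subalg_mem y -> subalg_mem (x * y)
}.

Section KSubalgebra.
Variables (K : fieldType) (A : kalg K) (S : subalgebra A).

Definition subalg_pred : A -> bool := fun x => `[< S x >].

Lemma subalg_predP x : reflect (S x) (x \in subalg_pred).
Proof. exact: asboolP. Qed.

Lemma subalg_pred_closed : subring_closed subalg_pred.
Proof.
split=> [|x y /subalg_predP Sx /subalg_predP Sy
         |x y /subalg_predP Sx /subalg_predP Sy]; apply/subalg_predP.
- by rewrite -(rmorph1 (kscal A)); apply: subalg_scal.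
- exact: subalgB.
- exact: subalgM.
Qed.

HB.instance Definition _ :=
  GRing.isSubringClosed.Build A subalg_pred subalg_pred_closed.

Record subalg_sort := SubalgSort {
  subalg_val :> A;
  subalg_valP : subalg_val \in subalg_pred
}.

HB.instance Definition _ := [isSub for subalg_val].
HB.instance Definition _ := [Choice of subalg_sort by <:].
HB.instance Definition _ := 
  GRing.SubChoice_isSubComPzRing.Build A subalg_pred subalg_sort subalg_pred_closed.

Definition subalg_in x (Sx : S x) : subalg_sort :=
  SubalgSort (introT (subalg_predP x) Sx).

Definition ksub_scal (a : K) : subalg_sort := subalg_in (subalg_scal S a).

Lemma ksub_scal_zmod : zmod_morphism ksub_scal.
Proof. by move=> a b; apply: val_inj; rewrite /= rmorphB. Qed.

Lemma ksub_scal_monoid : monoid_morphism ksub_scal.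
Proof. by split=> [|a b]; apply: val_inj; rewrite /= ?rmorph1 ?rmorphM. Qed.

HB.instance Definition _ := GRing.isZmodMorphism.Build K _ _ ksub_scal_zmod.
HB.instance Definition _ :=
  GRing.isMonoidMorphism.Build K _ _ ksub_scal_monoid.

Definition ksub : kalg K := KAlg ksub_scal.

End KSubalgebra.

(* The direct limit of A 0 -> A 1 -> ... is the ring of sequences that are     *)
(* eventually coherent, modulo those that are eventually zero: the image of    *)
(* a : A n is the class of any sequence with s n = a that is coherent from     *)
(* rank n on.                                                                  *)
Section DirectLimit.
Variables (K : fieldType) (A : nat -> kalg K).
Variable trans : forall n, khom (A n) (A n.+1).

Definition coherent_from N (s : kprod A) :=
  forall n, (N <= n)%N -> s n.+1 = trans n (s n).

Lemma coherent_scal a : exists N, coherent_from N (kscal (kprod A) a).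
Proof. by exists 0%N => n _; rewrite /= /kprod_scal khom_scal. Qed.

Lemma coherentB (s t : kprod A) :
  (exists N, coherent_from N s) -> (exists N, coherent_from N t) ->
  exists N, coherent_from N (s - t).
Proof.
move=> [N sN] [M tM]; exists (maxn N M) => n; rewrite geq_max => /andP[Nn Mn].
by rewrite [LHS](_ : _ = s n.+1 - t n.+1) // sN // tM // -rmorphB.
Qed.

Lemma coherentM (s t : kprod A) :
  (exists N, coherent_from N s) -> (exists N, coherent_from N t) ->
  exists N, coherent_from N (s * t).
Proof.
move=> [N sN] [M tM]; exists (maxn N M) => n; rewrite geq_max => /andP[Nn Mn].
by rewrite [LHS](_ : _ = s n.+1 * t n.+1) // sN // tM // -rmorphM.
Qed.

Definition coherent : subalgebra (kprod A) :=
  Subalgebra coherent_scal coherentB coherentM.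

Definition evt_zero (s : ksub coherent) :=
  exists N, forall n, (N <= n)%N -> subalg_val s n = 0.

Lemma evt_zero0 : evt_zero 0.
Proof. by exists 0%N. Qed.

Lemma evt_zeroD s t : evt_zero s -> evt_zero t -> evt_zero (s + t).
Proof.
move=> [N sN] [M tM]; exists (maxn N M) => n; rewrite geq_max => /andP[Nn Mn].
by rewrite [LHS](_ : _ = subalg_val s n + subalg_val t n) // sN // tM // addr0.
Qed.

Lemma evt_zeroM s t : evt_zero t -> evt_zero (s * t).
Proof.
move=> [N tN]; exists N => n Nn.
by rewrite [LHS](_ : _ = subalg_val s n * subalg_val t n) // tN // mulr0.
Qed.

Definition evt_zero_ideal : ideal (ksub coherent) :=
  Ideal evt_zero0 evt_zeroD evt_zeroM.

Definition dirlim : kalg K := kquot evt_zero_ideal.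

Definition dirlim_of (s : kprod A) (cs : coherent s) : dirlim :=
  kproj evt_zero_ideal (subalg_in cs).

Lemma dirlim_ofP (a : dirlim) : exists s (cs : coherent s), a = dirlim_of cs.
Proof.
have [[s s_in] ->] := qproj_surj a.
have cs := elimT (subalg_predP coherent s) s_in; exists s, cs.
by congr (qproj _ _); apply: val_inj.
Qed.

Lemma dirlim_of_eq s t (cs : coherent s) (ct : coherent t) :
  (exists N, forall n, (N <= n)%N -> s n = t n) <-> dirlim_of cs = dirlim_of ct.
Proof.
split=> [[N st]|/qproj_inj[N st]]; last first.
  by exists N => n /st e; apply/eqP; rewrite -subr_eq0; apply/eqP.
by apply: qproj_eq; exists N => n /st e; rewrite [LHS](_ : _ = s n - t n) // e subrr.
Qed.

(* The union over n of the images of the ideals I n *)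
Section DirectLimitIdeal.
Variable I : forall n, ideal (A n).
Hypothesis transI : forall n x, I n x -> I n.+1 (trans n x).

Definition dirlim_ideal_mem (a : dirlim) :=
  exists s (cs : coherent s),
    a = dirlim_of cs /\ exists n, coherent_from n s /\ I n (s n).

Lemma coherent_in_ideal n s :
  coherent_from n s -> I n (s n) -> forall m, (n <= m)%N -> I m (s m).
Proof.
move=> cs Is; elim=> [|m IHm]; first by rewrite leqn0 => /eqP <-.
rewrite leq_eqVlt => /predU1P[<- //|]; rewrite ltnS => nm.
by rewrite cs //; apply: transI; apply: IHm.
Qed.

Lemma dirlim_ideal0 : dirlim_ideal_mem 0.
Proof.
have c0 : coherent (0 : kprod A).
  by exists 0%N => n _; rewrite [RHS](_ : _ = trans n 0) // rmorph0.
exists 0, c0; split; last first.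
  exists 0%N; split; last exact: ideal0.
  by move=> n _; rewrite [RHS](_ : _ = trans n 0) // rmorph0.
rewrite -(rmorph0 (kproj evt_zero_ideal)); congr (qproj _ _).
exact: val_inj.
Qed.

Lemma dirlim_idealD a b :
  dirlim_ideal_mem a -> dirlim_ideal_mem b -> dirlim_ideal_mem (a + b).
Proof.
move=> [s [cs [-> [n [csn Is]]]]] [t [ct [-> [m [ctm It]]]]].
have cst k : (n <= k)%N -> (m <= k)%N -> (s + t) k.+1 = trans k ((s + t) k).
  move=> nk mk; rewrite [LHS](_ : _ = s k.+1 + t k.+1) // csn // ctm //.
  by rewrite -rmorphD.
have cstM : coherent_from (maxn n m) (s + t).
  by move=> k; rewrite geq_max => /andP[nk mk]; apply: cst.
have cst' : coherent (s + t) by exists (maxn n m).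
exists (s + t), cst'; split.
  rewrite /dirlim_of -(rmorphD (kproj evt_zero_ideal)); congr (qproj _ _).
  exact: val_inj.
exists (maxn n m); split=> //.
rewrite [X in I _ X](_ : _ = s (maxn n m) + t (maxn n m)) //.
apply: idealD.
  exact: (coherent_in_ideal csn Is (leq_maxl _ _)).
exact: (coherent_in_ideal ctm It (leq_maxr _ _)).
Qed.

Lemma dirlim_idealM a b : dirlim_ideal_mem b -> dirlim_ideal_mem (a * b).
Proof.
have [s [cs ->]] := dirlim_ofP a; case: (cs) => n csn.
move=> [t [ct [-> [m [ctm It]]]]].
have cstM : coherent_from (maxn n m) (s * t).
  move=> k; rewrite geq_max => /andP[nk mk].
  rewrite [LHS](_ : _ = s k.+1 * t k.+1) // csn // ctm //.
  by rewrite -rmorphM.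
have cst' : coherent (s * t) by exists (maxn n m).
exists (s * t), cst'; split.
  rewrite /dirlim_of -(rmorphM (kproj evt_zero_ideal)); congr (qproj _ _).
  exact: val_inj.
exists (maxn n m); split=> //.
rewrite [X in I _ X](_ : _ = s (maxn n m) * t (maxn n m)) //.
by apply: idealM; exact: (coherent_in_ideal ctm It (leq_maxr _ _)).
Qed.

Definition dirlim_ideal : ideal dirlim :=
  Ideal dirlim_ideal0 dirlim_idealD dirlim_idealM.

End DirectLimitIdeal.

(* Morphisms f n : A n -> A n.+1 commuting with the transition morphisms act   *)
(* on the direct limit, the class of (s 0, s 1, ...) going to that of          *)
(* (0, f 0 (s 0), f 1 (s 1), ...).                                             *)
Section DirectLimitShift.
Variable f : forall n, khom (A n) (A n.+1).
Hypothesis ftrans : forall n x, f n.+1 (trans n x) = trans n.+1 (f n x).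

Definition shift_seq (s : kprod A) : kprod A :=
  fun n => if n is n'.+1 then f n' (s n') else 0.

Lemma shift_seq_coherent_from N s :
  coherent_from N s -> coherent_from N.+1 (shift_seq s).
Proof. by move=> cs [//|n]; rewrite ltnS => Nn; rewrite /= cs // ftrans. Qed.

Lemma shift_seq_coherent s : coherent s -> coherent (shift_seq s).
Proof. by move=> [N cs]; exists N.+1; apply: shift_seq_coherent_from. Qed.

Definition shift_dirlim_sub (s : ksub coherent) : dirlim :=
  dirlim_of (shift_seq_coherent (elimT (subalg_predP _ _) (subalg_valP s))).

Lemma shift_dirlim_sub_zmod : zmod_morphism shift_dirlim_sub.
Proof.
move=> s t; rewrite /shift_dirlim_sub /dirlim_of.
rewrite -(rmorphB (kproj evt_zero_ideal)); apply: qproj_eq.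
exists 1%N => -[//|n] _.
set u := subalg_val _.
rewrite [LHS](_ : _ = f n (subalg_val s n - subalg_val t n)
                      - (f n (subalg_val s n) - f n (subalg_val t n))) //.
by rewrite rmorphB subrr.
Qed.

Lemma shift_dirlim_sub_monoid : monoid_morphism shift_dirlim_sub.
Proof.
split=> [|s t]; rewrite /shift_dirlim_sub /dirlim_of.
  rewrite -(rmorph1 (kproj evt_zero_ideal)); apply: qproj_eq.
  exists 1%N => -[//|n] _.
  by rewrite [LHS](_ : _ = f n 1 - 1) // rmorph1 subrr.
rewrite -(rmorphM (kproj evt_zero_ideal)); apply: qproj_eq.
exists 1%N => -[//|n] _.
rewrite [LHS](_ : _ = f n (subalg_val s n * subalg_val t n)
                      - (f n (subalg_val s n) * f n (subalg_val t n))) //.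
by rewrite rmorphM subrr.
Qed.

HB.instance Definition _ := GRing.isZmodMorphism.Build (ksub coherent) dirlim
  shift_dirlim_sub shift_dirlim_sub_zmod.
HB.instance Definition _ := GRing.isMonoidMorphism.Build (ksub coherent) dirlim
  shift_dirlim_sub shift_dirlim_sub_monoid.

Lemma shift_dirlim_sub_scal a :
  shift_dirlim_sub (kscal (ksub coherent) a) = kscal dirlim a.
Proof.
apply: qproj_eq; exists 1%N => -[//|n] _.
rewrite [LHS](_ : _ = f n (kscal (A n) a) - kscal (A n.+1) a) //.
by rewrite khom_scal subrr.
Qed.

Lemma shift_dirlim_sub_evt_zero s : evt_zero_ideal s -> shift_dirlim_sub s = 0.
Proof.
move=> [N sN]; rewrite -(rmorph0 (kproj evt_zero_ideal)); apply: qproj_eq.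
exists N.+1 => -[//|n]; rewrite ltnS => Nn.
by rewrite [LHS](_ : _ = f n (subalg_val s n) - 0) // sN // rmorph0 subrr.
Qed.

Definition shift_dirlim : khom dirlim dirlim :=
  @klift K (ksub coherent) evt_zero_ideal dirlim
    (KHom shift_dirlim_sub_scal) shift_dirlim_sub_evt_zero.

Lemma shift_dirlim_of s (cs : coherent s) :
  shift_dirlim (dirlim_of cs) = dirlim_of (shift_seq_coherent cs).
Proof.
rewrite /dirlim_of [LHS]qlift_proj; congr (qproj _ _).
exact: val_inj.
Qed.

End DirectLimitShift.

End DirectLimit.

(* The completion of A for a family of ideals F X decreasing in X is the       *)
(* inverse limit of the quotients A / F X.                                     *)
Section Completion.
Variables (K : fieldType) (A : kalg K).
Variable F : {posnum rat} -> ideal A.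

Definition compatible_mem (x : kprod (fun X => kquot (F X))) :=
  forall X Y : {posnum rat}, X%:num <= Y%:num ->
    exists a : A, x X = kproj (F X) a /\ x Y = kproj (F Y) a.

Lemma compatible_scal a : compatible_mem (kscal _ a).
Proof. by move=> X Y _; exists (kscal A a). Qed.

Lemma compatibleB x y :
  compatible_mem x -> compatible_mem y -> compatible_mem (x - y).
Proof.
move=> cx cy X Y XY; have [a [xX xY]] := cx X Y XY.
have [b [yX yY]] := cy X Y XY; exists (a - b).
by rewrite !(rmorphB (kproj _)) -xX -xY -yX -yY.
Qed.

Lemma compatibleM x y :
  compatible_mem x -> compatible_mem y -> compatible_mem (x * y).
Proof.
move=> cx cy X Y XY; have [a [xX xY]] := cx X Y XY.
have [b [yX yY]] := cy X Y XY; exists (a * b).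
by rewrite !(rmorphM (kproj _)) -xX -xY -yX -yY.
Qed.

Definition compatible : subalgebra (kprod (fun X => kquot (F X))) :=
  Subalgebra compatible_scal compatibleB compatibleM.

Definition completion : kalg K := ksub compatible.

Lemma completion_of_subproof a : compatible (fun X => kproj (F X) a).
Proof. by move=> X Y _; exists a. Qed.

Definition completion_of (a : A) : completion :=
  subalg_in (completion_of_subproof a).

End Completion.

Section CompletionMap.
Variables (K : fieldType) (A : kalg K) (F : {posnum rat} -> ideal A).
Variable f : khom A A.
Hypothesis fF : forall X x, F X x -> F X (f x).

Definition completion_map_fun (x : completion F) :
    kprod (fun X => kquot (F X)) :=
  fun X => kquot_map (@fF X) (subalg_val x X).

Lemma completion_map_compatible x : compatible F (completion_map_fun x).
Proof.
move=> X Y XY.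
have [a [xX xY]] := elimT (subalg_predP _ _) (subalg_valP x) X Y XY.
by exists (f a); rewrite /completion_map_fun xX xY !kquot_mapE.
Qed.

Definition completion_map_sub (x : completion F) : completion F :=
  subalg_in (completion_map_compatible x).

Lemma completion_map_zmod : zmod_morphism completion_map_sub.
Proof.
move=> x y; apply: val_inj; apply: functional_extensionality_dep => X.
exact: (rmorphB (kquot_map (@fF X))).
Qed.

Lemma completion_map_monoid : monoid_morphism completion_map_sub.
Proof.
split=> [|x y]; apply: val_inj; apply: functional_extensionality_dep => X.
  exact: (rmorph1 (kquot_map (@fF X))).
exact: (rmorphM (kquot_map (@fF X))).
Qed.

HB.instance Definition _ := GRing.isZmodMorphism.Build
  (completion F) (completion F) completion_map_sub completion_map_zmod.
HB.instance Definition _ := GRing.isMonoidMorphism.Build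
  (completion F) (completion F) completion_map_sub completion_map_monoid.

Lemma completion_map_scal a :
  completion_map_sub (kscal (completion F) a) = kscal (completion F) a.
Proof.
apply: val_inj; apply: functional_extensionality_dep => X.
exact: (khom_scal (kquot_map (@fF X))).
Qed.

Definition completion_map : khom (completion F) (completion F) :=
  KHom completion_map_scal.

Lemma completion_map_of a :
  completion_map (completion_of F a) = completion_of F (f a).
Proof.
apply: val_inj; apply: functional_extensionality_dep => X.
exact: (kquot_mapE (@fF X)).
Qed.

End CompletionMap.

(* K[[X_0, ..., X_(n-1)]], a series being its family of coefficients           *)
Section PowerSeries.
Variables (K : fieldType) (n : nat).

Definition pseries := 'X_{1..n} -> K.

HB.instance Definition _ := gen_eqMixin pseries.
HB.instance Definition _ := gen_choiceMixin pseries.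

Implicit Types p q r : pseries.
Implicit Types k m : 'X_{1..n}.

Lemma pseriesP p q : (forall m, p m = q m) <-> p = q.
Proof. by split=> [|-> //]; apply: functional_extensionality_dep. Qed.

Definition ps_zero : pseries := fun=> 0.
Definition ps_opp p : pseries := fun m => - p m.
Definition ps_add p q : pseries := fun m => p m + q m.
Definition ps_one : pseries := fun m => (m == 0%MM)%:R.
Definition ps_mul p q : pseries := fun m =>
  \sum_(k : 'X_{1..n < (mdeg m).+1} | (k <= m)%MM) p k * q (m - k)%MM.

Lemma ps_addA : associative ps_add.
Proof. by move=> p q r; apply/pseriesP => m; apply: addrA. Qed.
Lemma ps_addC : commutative ps_add.
Proof. by move=> p q; apply/pseriesP => m; apply: addrC. Qed.
Lemma ps_add0 : left_id ps_zero ps_add.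
Proof. by move=> p; apply/pseriesP => m; apply: add0r. Qed.
Lemma ps_addN : left_inverse ps_zero ps_opp ps_add.
Proof. by move=> p; apply/pseriesP => m; apply: addNr. Qed.

HB.instance Definition _ :=
  GRing.isZmodule.Build pseries ps_addA ps_addC ps_add0 ps_addN.

Definition mnm_below m : seq 'X_{1..n} :=
  map (@bmnm n (mdeg m).+1) (enum [pred k : 'X_{1..n < (mdeg m).+1} | (k <= m)%MM]).

Lemma lem_mdeg k m : (k <= m)%MM -> (mdeg k <= mdeg m)%N.
Proof. by move=> km; rewrite -(submK km) mdegD leq_addl. Qed.

Lemma mem_mnm_below m k : (k \in mnm_below m) = (k <= m)%MM.
Proof.
apply/mapP/idP => [[j]|km]; first by rewrite mem_enum inE => ? ->.
have dk : (mdeg k < (mdeg m).+1)%N by rewrite ltnS lem_mdeg.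
by exists (BMultinom dk); rewrite ?mem_enum ?inE.
Qed.

Lemma mnm_below_uniq m : uniq (mnm_below m).
Proof. by rewrite map_inj_uniq ?enum_uniq //; apply: val_inj. Qed.

Lemma ps_mulE p q m : ps_mul p q m = \sum_(k <- mnm_below m) p k * q (m - k)%MM.
Proof. by rewrite /ps_mul /mnm_below big_map big_enum. Qed.

Lemma subKm k m : (k <= m)%MM -> (m - (m - k) = k)%MM.
Proof.
by move=> /mnm_lepP km; apply/mnmP => i; rewrite !mnmBE subKn.
Qed.

Lemma ps_mulC : commutative ps_mul.
Proof.
move=> p q; apply/pseriesP => m; rewrite !ps_mulE.
have /(perm_big _)-> : perm_eq (mnm_below m)
    [seq (m - k)%MM | k <- mnm_below m].
  apply: uniq_perm; rewrite ?mnm_below_uniq //.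
    rewrite map_inj_in_uniq ?mnm_below_uniq // => k l.
    by rewrite !mem_mnm_below => /subKm {2}<- /subKm {2}<- ->.
  move=> k; rewrite mem_mnm_below; apply/idP/mapP => [km|[l _ ->]].
    by exists (m - k)%MM; rewrite ?mem_mnm_below ?lem_subr ?subKm.
  exact: lem_subr.
rewrite big_map; apply: eq_big_seq => k; rewrite mem_mnm_below => km.
by rewrite subKm // mulrC.
Qed.

Lemma ps_mulA : associative ps_mul.
Proof.
move=> p q r; apply/pseriesP => m; rewrite !ps_mulE.
have belowE k : (k <= m)%MM ->
    perm_eq (mnm_below k) [seq j <- mnm_below m | (j <= k)%MM].
  move=> km; apply: uniq_perm; rewrite ?filter_uniq ?mnm_below_uniq // => j.
  rewrite mem_filter !mem_mnm_below andb_idr // => jk.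
  exact: lepm_trans jk km.
pose T j k := p j * q (k - j)%MM * r (m - k)%MM.
transitivity (\sum_(j <- mnm_below m) \sum_(k <- mnm_below m | (j <= k)%MM) T j k).
  apply: eq_big_seq => j; rewrite mem_mnm_below => jm.
  rewrite ps_mulE mulr_sumr -[RHS]big_filter.
  have /(perm_big _)-> : perm_eq [seq k <- mnm_below m | (j <= k)%MM]
      [seq (j + i)%MM | i <- mnm_below (m - j)%MM].
    apply: uniq_perm; rewrite ?filter_uniq ?mnm_below_uniq //.
      rewrite map_inj_in_uniq ?mnm_below_uniq // => i i' _ _.
      exact: addmI.
    move=> k; rewrite mem_filter mem_mnm_below.
    apply/andP/mapP => [[jk km]|[i]].
      exists (k - j)%MM; last by rewrite addmC submK.
      rewrite mem_mnm_below; apply/mnm_lepP => x; rewrite !mnmBE.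
      by move/mnm_lepP: km => /(_ x); apply: leq_sub2r.
    rewrite mem_mnm_below => /mnm_lepP im ->.
    rewrite lem_addr; split=> //; apply/mnm_lepP => x.
    move/mnm_lepP: jm => /(_ x) jm; move: (im x).
    by rewrite mnmBE mnmDE -(leq_add2l (j x)) subnKC.
  rewrite [RHS]big_map; apply: eq_bigr => i _; rewrite /T mulrA.
  by rewrite [(j + i)%MM]addmC addmK [(i + j)%MM]addmC submDA.
rewrite (exchange_big_dep xpredT) //=; apply: eq_big_seq => k.
rewrite mem_mnm_below => km; rewrite ps_mulE mulr_suml.
by rewrite (perm_big _ (belowE k km)) big_filter.
Qed.

Lemma ps_mul1 : left_id ps_one ps_mul.
Proof.
move=> p; apply/pseriesP => m; rewrite ps_mulE.
have m0 : 0%MM \in mnm_below m.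
  by rewrite mem_mnm_below; apply/mnm_lepP => i; rewrite mnm0E.
rewrite (bigD1_seq 0%MM) ?mnm_below_uniq //= /ps_one eqxx mul1r subm0.
by rewrite big1 ?addr0 // => k /negbTE ->; rewrite mul0r.
Qed.

Lemma ps_mulDl : left_distributive ps_mul ps_add.
Proof.
move=> p q r; apply/pseriesP => m; rewrite [RHS]/ps_add !ps_mulE -big_split /=.
by apply: eq_bigr => k _; rewrite mulrDl.
Qed.

HB.instance Definition _ := GRing.Zmodule_isComPzRing.Build pseries
  ps_mulA ps_mulC ps_mul1 ps_mulDl.

Lemma psB p q m : (p - q) m = p m - q m.
Proof. by []. Qed.

Lemma psM p q m : (p * q) m = \sum_(k <- mnm_below m) p k * q (m - k)%MM.
Proof. exact: ps_mulE. Qed.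

Definition ps_const (a : K) : pseries := fun m => if m == 0%MM then a else 0.

Lemma ps_const_zmod : zmod_morphism ps_const.
Proof.
move=> a b; apply/pseriesP => m; rewrite psB /ps_const.
by case: eqP => // _; rewrite subr0.
Qed.

Lemma ps_const_monoid : monoid_morphism ps_const.
Proof.
split=> [|a b]; apply/pseriesP => m.
  by rewrite /ps_const [RHS](_ : _ = (m == 0%MM)%:R) //; case: eqP.
have m0 : 0%MM \in mnm_below m.
  by rewrite mem_mnm_below; apply/mnm_lepP => i; rewrite mnm0E.
rewrite psM (bigD1_seq 0%MM) ?mnm_below_uniq //= /ps_const eqxx subm0.
rewrite big1 ?addr0; last by move=> k /negbTE ->; rewrite mul0r.
by case: eqP => // _; rewrite mulr0.
Qed.

HB.instance Definition _ :=
  GRing.isZmodMorphism.Build K pseries ps_const ps_const_zmod.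
HB.instance Definition _ :=
  GRing.isMonoidMorphism.Build K pseries ps_const ps_const_monoid.

Definition kpseries : kalg K := KAlg ps_const.

Definition ps_var (i : 'I_n) : kpseries := fun m => (m == U_(i)%MM)%:R.


End PowerSeries.

(* The continuous substitution X_i |-> X_(h i) along an injection h: the       *)
(* coefficient of X^k vanishes when k involves a variable outside the image.   *)
Section RenameVariables.
Variables (K : fieldType) (m n : nat) (h : 'I_m -> 'I_n).

Definition ps_rename & injective h : pseries K m -> pseries K n := fun p k =>
  if [forall j, (j \in codom h) || (k j == 0%N)]
  then p [multinom k (h i) | i < m] else 0.

Hypothesis h_inj : injective h.
Local Notation rename := (ps_rename h_inj).
Let supp (k : 'X_{1..n}) := [forall j, (j \in codom h) || (k j == 0%N)].
Let pull (k : 'X_{1..n}) : 'X_{1..m} := [multinom k (h i) | i < m].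

Let pull_inj k l : supp k -> supp l -> pull k = pull l -> k = l.
Proof.
move=> /forallP sk /forallP sl kl; apply/mnmP => j.
have [/codomP[i ->]|hj] := boolP (j \in codom h).
  by move/mnmP: kl => /(_ i); rewrite !mnmE.
by move: (sk j) (sl j); rewrite (negbTE hj) /= => /eqP-> /eqP->.
Qed.

Let pull_surj l : exists2 k, supp k & pull k = l.
Proof.
exists [multinom \sum_(i < m | h i == j) l i | j < n].
  apply/forallP => j; have [//|hj /=] := boolP (j \in codom h).
  rewrite mnmE big1 // => i /eqP hij; case/negP: hj.
  by rewrite -hij codom_f.
apply/mnmP => i; rewrite !mnmE (big_pred1 i) // => i'.
by rewrite (inj_eq h_inj).
Qed.

Let supp_le k l : (k <= l)%MM -> supp l -> supp k.
Proof.
move=> /mnm_lepP kl /forallP sl; apply/forallP => j.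
by case/orP: (sl j) => [->//|/eqP lj]; move: (kl j); rewrite lj leqn0 orbC => ->.
Qed.

Let supp_sub k l : (k <= l)%MM -> supp k -> supp (l - k)%MM -> supp l.
Proof.
move=> /mnm_lepP kl /forallP sk /forallP slk; apply/forallP => j.
move: (sk j) (slk j); case: (j \in codom h) => //= /eqP kj.
by rewrite mnmBE kj subn0.
Qed.

Let pull_le k l : supp k -> (pull k <= pull l)%MM = (k <= l)%MM.
Proof.
move=> /forallP sk; apply/mnm_lepP/mnm_lepP => kl => [j|i]; last by rewrite !mnmE.
case/orP: (sk j) => [/codomP[i ->]|/eqP-> //].
by move: (kl i); rewrite !mnmE.
Qed.

Lemma ps_rename_zmod : zmod_morphism rename.
Proof.
move=> p q; apply/pseriesP => k; rewrite psB /ps_rename.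
by case: ifP => // _; rewrite subr0.
Qed.

Lemma ps_rename_monoid : monoid_morphism rename.
Proof.
have suppE p k : rename p k = if supp k then p (pull k) else 0 by [].
split=> [|p q]; apply/pseriesP => k.
  rewrite suppE [RHS](_ : _ = (k == 0%MM)%:R) //.
  have s0 : supp 0%MM by apply/forallP => j; rewrite mnm0E orbT.
  have p0 : pull 0%MM = 0%MM by apply/mnmP => i; rewrite !mnmE.
  case: (boolP (supp k)) => sk; last first.
    by case: eqP => // k0; move: sk; rewrite k0 s0.
  rewrite [LHS](_ : _ = (pull k == 0%MM)%:R) //; congr (nat_of_bool _)%:R.
  apply/eqP/eqP => [pk|->//]; apply: pull_inj => //.
  by rewrite p0.
rewrite suppE !psM; case: (boolP (supp k)) => sk; last first.
  rewrite big1_seq // => l /andP[_]; rewrite mem_mnm_below => lk.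
  rewrite !suppE; case: ifP => sl; last by rewrite mul0r.
  case: ifP => skl; last by rewrite mulr0.
  by case/negP: sk; apply: supp_sub lk sl skl.
have /(perm_big _)-> : perm_eq (mnm_below (pull k))
    [seq pull l | l <- mnm_below k].
  apply: uniq_perm; rewrite ?mnm_below_uniq //.
    rewrite map_inj_in_uniq ?mnm_below_uniq // => l l'.
    rewrite !mem_mnm_below => lk lk'.
    by apply: pull_inj; [apply: supp_le lk sk|apply: supp_le lk' sk].
  move=> l; rewrite mem_mnm_below; apply/idP/mapP => [|[l' + ->]].
    have [l' sl' <-] := pull_surj l; rewrite pull_le // => l'k.
    by exists l'; rewrite ?mem_mnm_below.
  by rewrite mem_mnm_below => l'k; rewrite pull_le //; apply: supp_le l'k sk.
rewrite big_map; apply: eq_big_seq => l; rewrite mem_mnm_below => lk.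
rewrite !suppE (supp_le lk sk) (supp_le (lem_subr k l) sk).
by congr (_ * q _); apply/mnmP => i; rewrite !(mnmE, mnmBE).
Qed.

HB.instance Definition _ := GRing.isZmodMorphism.Build
  (pseries K m) (pseries K n) (ps_rename h_inj) ps_rename_zmod.
HB.instance Definition _ := GRing.isMonoidMorphism.Build
  (pseries K m) (pseries K n) (ps_rename h_inj) ps_rename_monoid.

Lemma ps_rename_scal a :
  rename (kscal (kpseries K m) a) = kscal (kpseries K n) a.
Proof.
apply/pseriesP => k; rewrite /= /ps_rename /ps_const.
have s0 : supp 0%MM by apply/forallP => j; rewrite mnm0E orbT.
have p0 : pull 0%MM = 0%MM by apply/mnmP => i; rewrite !mnmE.
rewrite -/(supp k) -/(pull k); case: ifP => sk.
  congr (if _ then _ else _); apply/eqP/eqP => [pk|->//].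
  by apply: pull_inj => //; rewrite p0.
by case: eqP => // k0; rewrite k0 s0 in sk.
Qed.

Definition kps_rename : khom (kpseries K m) (kpseries K n) :=
  @KHom K (kpseries K m) (kpseries K n) (ps_rename h_inj) ps_rename_scal.

Lemma kps_rename_var i : kps_rename (ps_var K i) = ps_var K (h i).
Proof.
have s1 : supp U_(h i)%MM.
  apply/forallP => j; rewrite mnm1E.
  by have [<-|_] := eqVneq (h i) j; rewrite ?codom_f ?orbT.
have p1 : pull U_(h i)%MM = U_(i)%MM.
  by apply/mnmP => j; rewrite !(mnmE, mnm1E) (inj_eq h_inj).
apply/pseriesP => k; rewrite /= /ps_rename /ps_var -/(supp k) -/(pull k).
case: ifP => sk; last by case: eqP => // k1; rewrite k1 s1 in sk.
congr (nat_of_bool _)%:R; apply/eqP/eqP => [pk|->//].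
by apply: pull_inj => //; rewrite p1.
Qed.

End RenameVariables.

Lemma ps_rename_comp (K : fieldType) l m n (h : 'I_m -> 'I_n) (h' : 'I_l -> 'I_m)
    (hI : injective h) (hI' : injective h') (hhI : injective (h \o h')) :
  ps_rename hI \o ps_rename hI' =1 @ps_rename K _ _ _ hhI.
Proof.
move=> p; apply/pseriesP => k; rewrite /= /ps_rename.
case: ifP => [/forallP sk|/forallP sk]; last first.
  case: ifP => // /forallP skk; case: sk => j.
  case/orP: (skk j) => [/codomP[i ->]|->]; last by rewrite orbT.
  by rewrite /= codom_f.
have -> : [forall j, (j \in codom h') || ([multinom k (h i) | i < m] j == 0%N)]
    = [forall j, (j \in codom (h \o h')) || (k j == 0%N)].
  apply/forallP/forallP => skk j.
    case/orP: (sk j) => [/codomP[i ->]|->]; last by rewrite orbT.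
    move: (skk i); rewrite mnmE => /orP[/codomP[i' ->]|->]; last by rewrite orbT.
    by rewrite (codom_f (h \o h')).
  rewrite mnmE; case/orP: (skk (h j)) => [/codomP[i /hI ->]|->].
    by rewrite codom_f.
  by rewrite orbT.
by case: ifP => // _; congr (p _); apply/mnmP => i; rewrite !mnmE.
Qed.

Lemma ps_rename_ext (K : fieldType) m n (h h' : 'I_m -> 'I_n)
    (hI : injective h) (hI' : injective h') :
  h =1 h' -> @ps_rename K _ _ _ hI =1 ps_rename hI'.
Proof.
move=> hh'; have {}hh' : h = h' by apply: functional_extensionality_dep.
by subst h'; rewrite (Prop_irrelevance hI hI').
Qed.

(* y ^ k * p (1 / y) for p of degree at most k *)
Definition recip (K : fieldType) (A : kalg K) k (p : {poly K}) (y : A) : A :=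
  \sum_(j < k.+1) kscal A p`_j * y ^+ (k - j).

Section PathSpace.
Variables (K : fieldType) (d e : nat) (f g : {poly K}).

(* w_(i+1)^e w_i^d (g(1/w_(i+1)) - f(1/w_i)) as a polynomial in w_i, w_(i+1)   *)
Definition path_rel n (i : 'I_n) : kpseries K n.+1 :=
  let w := ps_var K (widen_ord (leqnSn n) i) in
  let w' := ps_var K (lift ord0 i) in
  w ^+ d * recip e g w' - w' ^+ e * recip d f w.

Definition path_quot n : kalg K := kquot (ideal_span (@path_rel n)).

Definition weight n (m : 'X_{1..n}) : rat :=
  \sum_(i < n) (m i)%:R * (d%:R / e%:R) ^+ i.

Definition weight_gt n (X : rat) (p : pseries K n) :=
  forall m, p m != 0 -> X < weight m.

Lemma weight_ge0 n (m : 'X_{1..n}) : 0 <= weight m.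
Proof. by apply: sumr_ge0 => i _; rewrite mulr_ge0 ?exprn_ge0 ?divr_ge0. Qed.

Lemma weightD n (m m' : 'X_{1..n}) : weight (m + m')%MM = weight m + weight m'.
Proof.
by rewrite /weight -big_split; apply: eq_bigr => i _; rewrite mnmDE natrD mulrDl.
Qed.

Section WeightIdeal.
Variables (n : nat) (X : rat).

Definition weight_ideal_mem (s : path_quot n) :=
  exists p : kpseries K n.+1, weight_gt X p /\ s = kproj _ p.

Lemma weight_ideal0 : weight_ideal_mem 0.
Proof.
exists 0; split; last by rewrite (rmorph0 (kproj _)).
by move=> m; rewrite [(0 : kpseries K _) m](_ : _ = 0) ?eqxx.
Qed.

Lemma weight_idealD s t :
  weight_ideal_mem s -> weight_ideal_mem t -> weight_ideal_mem (s + t).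
Proof.
move=> [p [pX ->]] [q [qX ->]]; exists (p + q); split; last first.
  by rewrite (rmorphD (kproj _)).
move=> m; rewrite [(p + q) m](_ : _ = p m + q m) //.
have [->|/pX //] := eqVneq (p m) 0.
by rewrite add0r; apply: qX.
Qed.

Lemma weight_idealM a s : weight_ideal_mem s -> weight_ideal_mem (a * s).
Proof.
have [q ->] := qproj_surj a; move=> [p [pX ->]]; exists (q * p); split.
  move=> m; rewrite psM => qp0.
  have /hasP[k] : has (fun k => q k * p (m - k)%MM != 0) (mnm_below m).
    apply: contraNT qp0 => /hasPn qp0; rewrite big1_seq // => k /andP[_ km].
    by apply/eqP; have := qp0 k km; rewrite negbK.
  rewrite mem_mnm_below => km; rewrite mulf_eq0 negb_or => /andP[_ /pX].
  move=> /lt_le_trans; apply.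
  by rewrite -{2}(submK km) weightD lerDl weight_ge0.
by rewrite (rmorphM (kproj _)).
Qed.

Definition weight_ideal : ideal (path_quot n) :=
  Ideal weight_ideal0 weight_idealD weight_idealM.

End WeightIdeal.

Section RenameWeight.
Variables (m n : nat) (h : 'I_m.+1 -> 'I_n.+1) (h_inj : injective h) (c : nat).
Hypothesis hE : forall i, h i = (c + i)%N :> nat.
Hypothesis c1 : (0 < c)%N -> 1 <= d%:R / e%:R :> rat.

Lemma weight_rename X (p : pseries K m.+1) :
  weight_gt X p -> weight_gt X (ps_rename h_inj p).
Proof.
move=> pX k; rewrite /ps_rename; case: ifP; last by rewrite eqxx.
move=> /forallP sk /pX /lt_le_trans; apply.
rewrite {2}/weight (bigID (fun j => j \in codom h)) /= [X in _ <= _ + X]big1 ?addr0; last first.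
  by move=> j hj; move: (sk j); rewrite (negbTE hj) /= => /eqP ->; rewrite mul0r.
rewrite -big_uniq; last by rewrite map_inj_uniq ?enum_uniq.
rewrite big_map big_enum /=; apply: ler_sum => i _; rewrite mnmE hE.
rewrite ler_wpM2l // exprD ler_peMl ?exprn_ge0 ?divr_ge0 //.
case: (posnP c) => [->|/c1 c1']; first by rewrite expr0.
exact: exprn_ege1.
Qed.

End RenameWeight.

Lemma recip_khom (A B : kalg K) (u : khom A B) k p y :
  u (recip k p y) = recip k p (u y).
Proof.
rewrite /recip rmorph_sum; apply: eq_bigr => j _.
by rewrite rmorphM khom_scal rmorphXn.
Qed.

Section RenameRel.
Variables (m n : nat) (h : 'I_m.+1 -> 'I_n.+1) (h_inj : injective h).
Variable h' : 'I_m -> 'I_n.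
Hypothesis h_lo : forall i,
  h (widen_ord (leqnSn m) i) = widen_ord (leqnSn n) (h' i).
Hypothesis h_hi : forall i, h (lift ord0 i) = lift ord0 (h' i).

Lemma path_rel_rename i : kps_rename K h_inj (path_rel i) = path_rel (h' i).
Proof.
rewrite /path_rel rmorphB !rmorphM !rmorphXn !recip_khom !kps_rename_var.
by rewrite h_lo h_hi.
Qed.

Lemma span_rename x :
  ideal_span (@path_rel m) x -> ideal_span (@path_rel n) (kps_rename K h_inj x).
Proof.
move=> [c ->]; rewrite rmorph_sum; elim/big_ind: _ => [|y z Iy Iz|i _].
- exact: ideal0.
- exact: idealD.
rewrite rmorphM; apply: idealM; rewrite path_rel_rename.
exists (fun j => (j == h' i)%:R).
rewrite (bigD1 (h' i)) //= eqxx mul1r big1 ?addr0 // => j /negbTE ->.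
by rewrite mul0r.
Qed.

End RenameRel.

Section Transitions.
Variable n : nat.

Let lo : 'I_n.+1 -> 'I_n.+2 := widen_ord (leqnSn n.+1).
Let hi : 'I_n.+1 -> 'I_n.+2 := lift ord0.

Lemma lo_inj : injective lo.
Proof. by move=> i j /(congr1 val) /= ij; apply: val_inj. Qed.

Lemma hi_inj : injective hi.
Proof. exact: lift_inj. Qed.

Lemma span_lo x : ideal_span (@path_rel n) x ->
  ideal_span (@path_rel n.+1) (kps_rename K lo_inj x).
Proof.
by apply: (@span_rename _ _ lo _ (widen_ord (leqnSn n))) => i; apply: val_inj.
Qed.

Lemma span_hi x : ideal_span (@path_rel n) x ->
  ideal_span (@path_rel n.+1) (kps_rename K hi_inj x).
Proof. by apply: (@span_rename _ _ hi _ (lift ord0)) => i; apply: val_inj. Qed.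

Definition path_trans : khom (path_quot n) (path_quot n.+1) :=
  kquot_map span_lo.

(* w_i |-> w_(i+1) *)
Definition path_step : khom (path_quot n) (path_quot n.+1) :=
  kquot_map span_hi.

Lemma path_trans_weight X x :
  weight_ideal n X x -> weight_ideal n.+1 X (path_trans x).
Proof.
move=> [p [pX ->]]; exists (kps_rename K lo_inj p).
split; last exact: kquot_mapE.
exact: (@weight_rename _ _ lo lo_inj 0%N).
Qed.

Lemma path_step_weight X x : (1 <= e < d)%N ->
  weight_ideal n X x -> weight_ideal n.+1 X (path_step x).
Proof.
move=> /andP[e0 /ltnW ed] [p [pX ->]]; exists (kps_rename K hi_inj p).
split; last exact: kquot_mapE.
apply: (@weight_rename _ _ hi hi_inj 1%N) => // _.
by rewrite ler_pdivlMr ?ltr0n // mul1r ler_nat.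
Qed.

End Transitions.

Definition path_limit : kalg K := dirlim path_trans.

Definition path_filtration (X : {posnum rat}) : ideal path_limit :=
  dirlim_ideal (fun n => @path_trans_weight n X%:num).

(* The completed local ring of the path space of g(y) = f(x) at infinity *)
Definition path_ring : kalg K := completion path_filtration.

Lemma path_step_trans n x :
  path_step n.+1 (path_trans n x) = path_trans n.+1 (path_step n x).
Proof.
have [p ->] := qproj_surj x; rewrite /path_step /path_trans.
rewrite -[qproj _ p]/(kproj _ p) !kquot_mapE; congr (kproj _ _).
have I1 := inj_comp (@hi_inj n.+1) (@lo_inj n).
have I2 := inj_comp (@lo_inj n.+1) (@hi_inj n).
rewrite [LHS](ps_rename_comp _ _ I1) [RHS](ps_rename_comp _ _ I2).
by apply: ps_rename_ext => i; apply: val_inj.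
Qed.

Definition path_limit_shift : khom path_limit path_limit :=
  shift_dirlim path_step_trans.

Section Shift.
Hypothesis hde : (1 <= e < d)%N.

Lemma path_limit_shift_filtration X a :
  path_filtration X a -> path_filtration X (path_limit_shift a).
Proof.
move=> [s [cs [-> [n [csn Is]]]]].
exists (shift_seq path_step s), (shift_seq_coherent path_step_trans cs).
split; first exact: shift_dirlim_of.
exists n.+1; split; last exact: path_step_weight.
exact: shift_seq_coherent_from path_step_trans _ _ csn.
Qed.

Definition path_shift : khom path_ring path_ring :=
  completion_map path_limit_shift_filtration.

End Shift.

Definition coord_seq (i : nat) : kprod path_quot :=
  fun n => if (i <= n)%N then kproj _ (ps_var K (inord i)) else 0.

Lemma coord_seq_coherent i : coherent path_trans (coord_seq i).
Proof.
exists i => n ni; rewrite /coord_seq (leqW ni) ni /path_trans kquot_mapE.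
rewrite kps_rename_var; congr (kproj _ (ps_var _ _)).
by apply: val_inj; rewrite /= !inordK // ltnS // leqW.
Qed.

Definition coord (i : nat) : path_ring :=
  completion_of path_filtration (dirlim_of (coord_seq_coherent i)).

Lemma path_shift_coord (hde : (1 <= e < d)%N) i :
  path_shift hde (coord i) = coord i.+1.
Proof.
rewrite /path_shift /coord completion_map_of /path_limit_shift shift_dirlim_of.
congr (completion_of _ _); apply/dirlim_of_eq; exists i.+1 => -[//|n].
rewrite ltnS => ni; rewrite /shift_seq /coord_seq ni ltnS ni.
rewrite /path_step kquot_mapE kps_rename_var; congr (kproj _ (ps_var _ _)).
by apply: val_inj; rewrite /= !inordK // ?ltnS.
Qed.

Definition path_space_at_infty : kfunctor K := Spec path_ring.

Definition shift_at_infty (hde : (1 <= e < d)%N) :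
    kmor path_space_at_infty path_space_at_infty :=
  Spec_map (path_shift hde).

End PathSpace.

(* Main.v *)
(** Write [w = w_0], [F (y) = y^d f(1/y)] and [G (y) = y^e g(1/y)], so that the
relations read [w^d G(s w) = (s w)^e F(w)], where [s] is the shift. Given a
second pair [f', g'], the element [w k] with [k] congruent to 1 satisfies the
relations of [f', g'] as soon as
  [k^d F(w) G'(s(w k)) = G(s w) F'(w k) (s k)^e].
Since [s] multiplies weights by [d/e > 1] and [w] has weight 1, the simplified
Newton step [k |-> k - (lhs - rhs)/d] raises the weight of differences by at
least [min 1 (d/e - 1)], so this equation has exactly one such solution, and
[w'_i |-> s^i (w k)] is a shift-equivariant morphism between the completed
local rings. The solutions multiply under composition of these morphisms, and
[k = 1] is the solution for [f', g' = f, g], so the morphisms of the pairs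
[(f, g), (x^d, y^e)] and [(x^d, y^e), (f, g)] are mutually inverse. *)
Require Import Defs.
From HB Require Import structures.
From mathcomp Require Import all_boot all_order all_algebra interval_inference.
From mathcomp Require Import boolp ring lra.
From mathcomp.multinomials Require Import mpoly.

Set Implicit Arguments.
Unset Strict Implicit.
Unset Printing Implicit Defensive.

Import Order.TTheory GRing.Theory Num.Theory.
Local Open Scope ring_scope.

(** * Evaluation of power series at nilpotent elements *)

Section PowerSeriesHom.
Variables (K : fieldType) (n : nat).
Implicit Types (p q : kpseries K n) (m : 'X_{1..n}).

Lemma ps_sumE (I : Type) (s : seq I) (P : pred I) (F : I -> kpseries K n) m :
  (\sum_(i <- s | P i) F i) m = \sum_(i <- s | P i) F i m.
Proof. by apply: (big_morph (fun p : kpseries K n => p m)). Qed.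

Lemma ps_varM i q m :
  (ps_var K i * q) m = if (U_(i) <= m)%MM then q (m - U_(i))%MM else 0.
Proof.
rewrite psM; case: ifP => im.
  rewrite (bigD1_seq U_(i)%MM) ?mnm_below_uniq ?mem_mnm_below //= /ps_var eqxx.
  by rewrite mul1r big1 ?addr0 // => k /negbTE->; rewrite mul0r.
rewrite big1_seq // => k /andP[_]; rewrite mem_mnm_below /ps_var.
by case: eqP => [->|_ _]; rewrite ?im // mul0r.
Qed.

(* Each monomial other than 1 is attributed to its first variable. *)
Definition ps_tail (i : 'I_n) p : kpseries K n := fun m =>
  if [forall j : 'I_n, (j < i)%N ==> (m j == 0%N)] then p (m + U_(i))%MM else 0.

Lemma ps_decomp p :
  p = kscal (kpseries K n) (p 0%MM) + \sum_i ps_var K i * ps_tail i p.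
Proof.
apply/pseriesP => m.
rewrite [RHS](_ : _ = ps_const (p 0%MM) m + (\sum_i ps_var K i * ps_tail i p) m) //.
rewrite ps_sumE /ps_const; have [->|m0] := eqVneq m 0%MM.
  rewrite big1 ?addr0 // => i _; rewrite ps_varM; case: ifP => // /mnm_lepP/(_ i).
  by rewrite mnm1E eqxx mnm0E.
have [i0 mi0] : exists i, m i != 0%N.
  apply/existsP; apply: contraNT m0; rewrite negb_exists => /forallP h.
  by apply/eqP/mnmP => i; rewrite mnm0E; move: (h i); rewrite negbK => /eqP.
(* Only the summand of the first variable [i] of [m] can contribute to the coefficient at [m]. *)
case: (@arg_minnP _ i0 (fun i => m i != 0%N) (fun i => i : nat) mi0) => i mi imin.
rewrite add0r (bigD1 i) //= big1 ?addr0 => [|j ji].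
  have Uim : (U_(i) <= m)%MM by rewrite lep1mP.
  rewrite ps_varM Uim /ps_tail submK // ifT //; apply/forallP => j.
  apply/implyP => ji; rewrite mnmBE mnm1E.
  have -> : m j = 0%N by apply/eqP; apply: contraTT ji => /imin; rewrite -leqNgt.
  by [].
rewrite ps_varM; case: ifP => // Ujm; rewrite /ps_tail; case: ifP => // /forallP/(_ i).
have ltij : (i < j)%N.
  by rewrite ltn_neqAle imin ?andbT -?lep1mP //; apply: contra ji => /eqP/val_inj->.
rewrite ltij mnmBE mnm1E (_ : (j == i) = false) ?subn0 /= ?(negbTE mi) //.
exact: negbTE.
Qed.

Lemma prod_expD (B : comPzRingType) (x : 'I_n -> B) m m' :
  \prod_i x i ^+ (m + m')%MM i = (\prod_i x i ^+ m i) * \prod_i x i ^+ m' i.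
Proof.
by rewrite -big_split; apply: eq_bigr => i _; rewrite mnmDE exprD.
Qed.

Lemma prod_exp1 (B : comPzRingType) (x : 'I_n -> B) i :
  \prod_j x j ^+ U_(i)%MM j = x i.
Proof.
rewrite (bigD1 i) //= mnm1E eqxx expr1 big1 ?mulr1 // => j ji.
by rewrite mnm1E eq_sym (negbTE ji) expr0.
Qed.

(** Nilpotency does the work of continuity: by [ps_decomp], [u p - v p] is a combination of the
    [x i] whose coefficients are differences of the same shape. Iterating brings in monomials of
    growing degree, which vanish from degree [N] on. *)
Lemma kpseries_hom_uniq (B : kalg K) (u v : khom (kpseries K n) B)
    (x : 'I_n -> B) N :
  (forall i, u (ps_var K i) = x i) -> (forall i, v (ps_var K i) = x i) ->
  (forall m, (N <= mdeg m)%N -> \prod_i x i ^+ m i = 0) ->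
  u =1 v.
Proof.
move=> ux vx nil p.
(* [j] bounds the number of degrees still missing to reach [N]; the case [j = N], [m = 0] is the
   goal. *)
suff /(_ N 0%MM p) : forall j m p, (N <= j + mdeg m)%N ->
    (\prod_i x i ^+ m i) * (u p - v p) = 0.
  rewrite mdeg0 addn0 => /(_ (leqnn _)); rewrite big1 => [|i _]; last first.
    by rewrite mnm0E expr0.
  by rewrite mul1r => /eqP; rewrite subr_eq0 => /eqP.
elim=> [|j IHj] m {}p Nj; first by rewrite nil ?mul0r.
rewrite [p]ps_decomp !rmorphD !khom_scal /= addrAC opprD addrA addrN add0r.
rewrite addrC !rmorph_sum -sumrB mulr_sumr big1 // => i _.
rewrite !rmorphM /= ux vx -mulrBr mulrA -(prod_exp1 x).
by rewrite -prod_expD IHj // mdegD mdeg1 addn1 -addSnnS.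
Qed.

Section Eval.
Variables (B : kalg K) (x : 'I_n -> B) (N : nat).
Hypothesis nil : forall m, (N <= mdeg m)%N -> \prod_i x i ^+ m i = 0.

(** Monomials of degree at least [N] vanish at [x], so the truncated sum is the value of the whole
    series. The nilpotency proof is an argument so that the morphism structures can be attached to
    [ps_eval nil]. *)
Definition ps_eval & (forall m, (N <= mdeg m)%N -> \prod_i x i ^+ m i = 0) :=
  fun p : kpseries K n =>
  \sum_(m : 'X_{1..n < N}) kscal B (p m) * \prod_i x i ^+ (m : 'X_{1..n}) i.
Local Notation eval := (ps_eval nil).

Lemma ps_eval_zmod : zmod_morphism eval.
Proof.
move=> p q; rewrite /ps_eval -sumrB; apply: eq_bigr => m _.
by rewrite psB rmorphB mulrBl.
Qed.

Let low := [seq bmnm m | m : 'X_{1..n < N}].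

Let lowE m : (m \in low) = (mdeg m < N)%N.
Proof.
apply/mapP/idP => [[k _ ->]|mN]; first exact: bmdeg.
by exists (BMultinom mN); rewrite ?mem_enum.
Qed.

Let low_uniq : uniq low.
Proof. by rewrite map_inj_uniq ?enum_uniq //; apply: val_inj. Qed.

Let evalE p : eval p = \sum_(m <- low) kscal B (p m) * \prod_i x i ^+ m i.
Proof. by rewrite big_map big_enum. Qed.

Lemma ps_eval_const a : eval (kscal (kpseries K n) a) = kscal B a.
Proof.
rewrite evalE.
have x0 : \prod_i x i ^+ (0%MM : 'X_{1..n}) i = 1.
  by rewrite big1 // => i _; rewrite mnm0E expr0.
have [N0|N0] := posnP N.
  (* For [N = 0] the empty monomial vanishes, so [B] is the zero ring. *)
  have B0 : (1 : B) = 0 by rewrite -x0 nil // N0.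
  by rewrite -[LHS]mul1r -[RHS]mul1r B0 !mul0r.
rewrite (bigD1_seq 0%MM) ?lowE ?mdeg0 //= x0 mulr1 big1 ?addr0.
  by rewrite /ps_const eqxx.
by move=> m /negbTE m0; rewrite /= /ps_const m0 rmorph0 mul0r.
Qed.

(** Both sides are double sums over pairs of exponents [k], [l]. Pairs with [k + l] of degree at
    least [N] occur only in the product of the two truncations, where they vanish by [nil]. *)
Lemma ps_eval_monoid : monoid_morphism eval.
Proof.
split=> [|p q].
  by rewrite -(rmorph1 (kscal (kpseries K n))) ps_eval_const rmorph1.
rewrite !evalE big_distrl /=.
pose T k m := kscal B (p k * q (m - k)%MM) * \prod_i x i ^+ m i.
transitivity (\sum_(m <- low) \sum_(k <- low | (k <= m)%MM) T k m).
  apply: eq_big_seq => m; rewrite lowE => mN.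
  rewrite psM rmorph_sum mulr_suml /= -[RHS]big_filter; apply: perm_big.
  apply: uniq_perm; rewrite ?filter_uniq ?mnm_below_uniq // => k.
  rewrite mem_filter mem_mnm_below andb_idr // => km.
  by rewrite lowE; apply: leq_ltn_trans (lem_mdeg km) mN.
rewrite (exchange_big_dep xpredT) //=; apply: eq_big_seq => k; rewrite lowE => kN.
rewrite mulr_sumr [RHS](bigID (fun l => (k + l)%MM \in low)) /=.
rewrite [X in _ = _ + X]big1 ?addr0; last first.
  move=> l; rewrite lowE -leqNgt => Nkl.
  by rewrite mulrACA -prod_expD nil ?mulr0.
rewrite -[LHS]big_filter -[RHS]big_filter.
have /(perm_big _)-> : perm_eq [seq m <- low | (k <= m)%MM]
    [seq (k + l)%MM | l <- [seq l <- low | (k + l)%MM \in low]].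
  apply: uniq_perm; rewrite ?filter_uniq //.
    by rewrite map_inj_in_uniq ?filter_uniq // => ? ? _ _; apply: addmI.
  move=> m; rewrite mem_filter lowE; apply/andP/mapP => [[km mN]|[l]].
    exists (m - k)%MM; last by rewrite addmC submK.
    rewrite mem_filter addmC submK // !lowE mN /=.
    exact: leq_ltn_trans (lem_mdeg (lem_subr _ _)) mN.
  by rewrite mem_filter !lowE => /andP[klN _] ->; rewrite lem_addr.
rewrite [LHS]big_map; apply: eq_bigr => l _.
by rewrite /T prod_expD [(k + l)%MM]addmC addmK rmorphM mulrACA.
Qed.

HB.instance Definition _ :=
  GRing.isZmodMorphism.Build (kpseries K n) B (ps_eval nil) ps_eval_zmod.
HB.instance Definition _ :=
  GRing.isMonoidMorphism.Build (kpseries K n) B (ps_eval nil) ps_eval_monoid.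

Definition kps_eval : khom (kpseries K n) B :=
  @KHom K (kpseries K n) B (ps_eval nil) ps_eval_const.

Lemma kps_eval_var i : kps_eval (ps_var K i) = x i.
Proof.
rewrite [LHS]evalE; have [N1|N1] := ltnP 1 N.
  rewrite (bigD1_seq U_(i)%MM) ?lowE ?mdeg1 //= prod_exp1 big1 ?addr0.
    by rewrite /ps_var eqxx rmorph1 mul1r.
  by move=> m /negbTE mi; rewrite /ps_var mi rmorph0 mul0r.
have -> : x i = 0 by rewrite -(prod_exp1 x) nil ?mdeg1.
rewrite big1_seq // => m; rewrite lowE /ps_var => /andP[_ mN].
case: eqP => [mi|_]; last by rewrite rmorph0 mul0r.
by move: mN; rewrite mi mdeg1 ltnNge N1.
Qed.

(** Meant for series of large weight: their monomials vanish at [x] even when their degree is below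
    the truncation bound. *)
Lemma kps_eval_eq0 p :
  (forall m, p m != 0 -> \prod_i x i ^+ m i = 0) -> kps_eval p = 0.
Proof.
move=> p0; rewrite [LHS]evalE big1 // => m _.
by have [->|/p0->] := eqVneq (p m) 0; rewrite ?rmorph0 (mul0r, mulr0).
Qed.

End Eval.
End PowerSeriesHom.

(** * Direct limits and completions *)

Section DirectLimit.
Variables (K : fieldType) (A : nat -> kalg K).
Variable trans : forall n, khom (A n) (A n.+1).
Local Notation lim := (dirlim trans).

(* The junk value 0 for [k < n] is harmless: only the tail matters. *)
Fixpoint push n (x : A n) k : A k :=
  match n =P k with
  | ReflectT nk => ecast j (A j) nk x
  | ReflectF _ => if k is k'.+1 then trans k' (push x k') else 0
  end.

Lemma push_id n (x : A n) : push x n = x.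
Proof. by case: n x => [|n] x /=; case: eqP => // nn; rewrite eq_axiomK. Qed.

Lemma pushS n (x : A n) k : (n <= k)%N -> push x k.+1 = trans k (push x k).
Proof. by move=> nk /=; case: eqP => // nk1; exfalso; move: nk; rewrite nk1 ltnn. Qed.

Lemma push_coherent n (x : A n) : coherent trans (push x).
Proof. by exists n => k; apply: pushS. Qed.

Lemma push_morph n (P : forall k, A k -> Prop) (x : A n) :
  P n x -> (forall k y, P k y -> P k.+1 (trans k y)) ->
  forall k, (n <= k)%N -> P k (push x k).
Proof.
move=> Px PS; elim=> [|k IHk].
  by rewrite leqn0 => /eqP n0; subst n; rewrite push_id.
rewrite leq_eqVlt => /predU1P[nk|]; first by subst n; rewrite push_id.
by rewrite ltnS => nk; rewrite pushS //; apply/PS/IHk.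
Qed.

Lemma pushB n (x y : A n) k : (n <= k)%N -> push (x - y) k = push x k - push y k.
Proof.
elim: k => [|k IHk]; first by rewrite leqn0 => /eqP n0; subst n; rewrite !push_id.
rewrite leq_eqVlt => /predU1P[nk|]; first by subst n; rewrite !push_id.
by rewrite ltnS => nk; rewrite !pushS // IHk // rmorphB.
Qed.

Lemma pushM n (x y : A n) k : (n <= k)%N -> push (x * y) k = push x k * push y k.
Proof.
elim: k => [|k IHk]; first by rewrite leqn0 => /eqP n0; subst n; rewrite !push_id.
rewrite leq_eqVlt => /predU1P[nk|]; first by subst n; rewrite !push_id.
by rewrite ltnS => nk; rewrite !pushS // IHk // rmorphM.
Qed.

Lemma push_scal n a k : (n <= k)%N -> push (kscal (A n) a) k = kscal (A k) a.
Proof.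
by apply: (@push_morph n (fun k y => y = kscal (A k) a)) => // l y ->;
  rewrite khom_scal.
Qed.

Definition dirlim_in_fun n (x : A n) : lim := dirlim_of (push_coherent x).

Lemma dirlim_in_zmod n : zmod_morphism (@dirlim_in_fun n).
Proof.
move=> x y; rewrite /dirlim_in_fun /dirlim_of -(rmorphB (kproj _)).
apply: qproj_eq; exists n => k nk; set u := subalg_val _.
rewrite [LHS](_ : _ = push (x - y) k - (push x k - push y k)) //.
by rewrite pushB // subrr.
Qed.

Lemma dirlim_in_scal n a : dirlim_in_fun (kscal (A n) a) = kscal lim a.
Proof.
apply: qproj_eq; exists n => k nk.
rewrite [LHS](_ : _ = push (kscal (A n) a) k - kscal (A k) a) //.
by rewrite push_scal // subrr.
Qed.

Lemma dirlim_in_monoid n : monoid_morphism (@dirlim_in_fun n).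
Proof.
split=> [|x y]; first by rewrite -(rmorph1 (kscal (A n))) dirlim_in_scal rmorph1.
rewrite /dirlim_in_fun /dirlim_of -(rmorphM (kproj _)).
apply: qproj_eq; exists n => k nk; set u := subalg_val _.
rewrite [LHS](_ : _ = push (x * y) k - (push x k * push y k)) //.
by rewrite pushM // subrr.
Qed.

HB.instance Definition _ n :=
  GRing.isZmodMorphism.Build (A n) lim (@dirlim_in_fun n) (@dirlim_in_zmod n).
HB.instance Definition _ n :=
  GRing.isMonoidMorphism.Build (A n) lim (@dirlim_in_fun n) (@dirlim_in_monoid n).

Definition dirlim_in n : khom (A n) lim :=
  @KHom K (A n) lim (@dirlim_in_fun n) (@dirlim_in_scal n).

Lemma dirlim_of_in n s (cs : coherent trans s) :
  coherent_from trans n s -> dirlim_of cs = dirlim_in n (s n).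
Proof.
move=> csn; apply/dirlim_of_eq; exists n => k nk; apply/esym.
elim: k nk => [|k IHk]; first by rewrite leqn0 => /eqP n0; subst n; rewrite push_id.
rewrite leq_eqVlt => /predU1P[nk|]; first by subst n; rewrite push_id.
by rewrite ltnS => nk; rewrite pushS // IHk // csn.
Qed.

(** Representatives are provided at all large stages, not just at one, so that several elements can
    be brought to a common stage. *)
Lemma dirlim_in_surj (a : lim) :
  exists N, forall n, (N <= n)%N -> exists x, a = dirlim_in n x.
Proof.
have [s [cs ->]] := dirlim_ofP a; case: (cs) => N csN; exists N => n Nn.
by exists (s n); apply: dirlim_of_in => k nk; apply/csN/leq_trans/nk.
Qed.

Section Lift.
Variables (B : kalg K) (u : forall n, khom (A n) B).
Hypothesis u_trans : forall n x, u n.+1 (trans n x) = u n x.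

Lemma push_lift n (x : A n) k : (n <= k)%N -> u k (push x k) = u n x.
Proof.
apply: (@push_morph n (fun k y => u k y = u n x)) => // l t <-.
exact: u_trans.
Qed.

Lemma dirlim_in_eq n m (x : A n) (y : A m) :
  dirlim_in n x = dirlim_in m y -> u n x = u m y.
Proof.
move=> /dirlim_of_eq[N xy]; pose k := maxn N (maxn n m).
rewrite -(push_lift x (k := k)) ?xy ?push_lift ?leq_max ?leqnn ?orbT //.
Qed.

(** A representative is picked by choice; [dirlim_in_eq] shows that the value [b] does not depend on
    it. *)
Lemma dirlim_in_ex (a : lim) : {b | exists n x, a = dirlim_in n x /\ b = u n x}.
Proof.
apply: cid; have [N /(_ N (leqnn _))[x ->]] := dirlim_in_surj a.
by exists (u N x), N, x.
Qed.

Definition dirlim_lift_fun & (forall n x, u n.+1 (trans n x) = u n x) :=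
  fun a : lim => sval (dirlim_in_ex a).
Local Notation lift := (dirlim_lift_fun u_trans).

Lemma dirlim_lift_in n x : lift (dirlim_in n x) = u n x.
Proof.
have [m [y [xy liftE]]] := svalP (dirlim_in_ex (dirlim_in n x)).
by rewrite /dirlim_lift_fun liftE -(dirlim_in_eq xy).
Qed.

Lemma dirlim_in2 (a b : lim) :
  exists n x y, a = dirlim_in n x /\ b = dirlim_in n y.
Proof.
have [N aN] := dirlim_in_surj a; have [M bM] := dirlim_in_surj b.
have [x ->] := aN _ (leq_maxl N M); have [y ->] := bM _ (leq_maxr N M).
by exists (maxn N M), x, y.
Qed.

Lemma dirlim_lift_zmod : zmod_morphism lift.
Proof.
move=> a b; have [n [x [y [-> ->]]]] := dirlim_in2 a b.
by rewrite -rmorphB !dirlim_lift_in rmorphB.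
Qed.

Lemma dirlim_lift_scal a : lift (kscal lim a) = kscal B a.
Proof. by rewrite -(khom_scal (dirlim_in 0)) dirlim_lift_in khom_scal. Qed.

Lemma dirlim_lift_monoid : monoid_morphism lift.
Proof.
split=> [|a b]; first by rewrite -(rmorph1 (kscal lim)) dirlim_lift_scal rmorph1.
have [n [x [y [-> ->]]]] := dirlim_in2 a b.
by rewrite -rmorphM !dirlim_lift_in rmorphM.
Qed.

HB.instance Definition _ :=
  GRing.isZmodMorphism.Build lim B (dirlim_lift_fun u_trans) dirlim_lift_zmod.
HB.instance Definition _ :=
  GRing.isMonoidMorphism.Build lim B (dirlim_lift_fun u_trans) dirlim_lift_monoid.

Definition dirlim_lift : khom lim B :=
  @KHom K lim B (dirlim_lift_fun u_trans) dirlim_lift_scal.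

End Lift.

(** Membership at one stage propagates along the transitions, so it can be tested at all large
    stages at once; sums and products are then computed at a common stage. *)
Lemma dirlim_idealP (I : forall n, ideal (A n))
    (transI : forall n x, I n x -> I n.+1 (trans n x)) (a : lim) :
  dirlim_ideal transI a <->
  exists N, forall n, (N <= n)%N -> exists x, a = dirlim_in n x /\ I n x.
Proof.
split=> [[s [cs [-> [N [csN Is]]]]]|[n /(_ n (leqnn _))[x [-> Ix]]]].
  exists N => n Nn; exists (s n); split.
    by apply: dirlim_of_in => k nk; apply/csN/leq_trans/nk.
  exact: (coherent_in_ideal transI csN Is Nn).
exists (push x), (push_coherent x); split=> //; exists n.
by split; [move=> k; apply: pushS | rewrite push_id].
Qed.

Section Shift.
Variable f : forall n, khom (A n) (A n.+1).
Hypothesis ftrans : forall n x, f n.+1 (trans n x) = trans n.+1 (f n x).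

Lemma shift_dirlim_in n x :
  shift_dirlim ftrans (dirlim_in n x) = dirlim_in n.+1 (f n x).
Proof.
rewrite [LHS]shift_dirlim_of (@dirlim_of_in n.+1).
  by rewrite /= push_id.
by apply: shift_seq_coherent_from => // k; apply: pushS.
Qed.

End Shift.

End DirectLimit.

(** * Completions: projections and Cauchy sequences *)

Section CompletionTheory.
Variables (K : fieldType) (A : kalg K) (F : {posnum rat} -> ideal A).
Local Notation C := (completion F).
Implicit Types (x y : C) (X Y : {posnum rat}).

Definition completion_at_fun X (x : C) : kquot (F X) := subalg_val x X.

Lemma completion_at_zmod X : zmod_morphism (@completion_at_fun X).
Proof. by []. Qed.

Lemma completion_at_monoid X : monoid_morphism (@completion_at_fun X).
Proof. by []. Qed.

HB.instance Definition _ X := GRing.isZmodMorphism.Build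
  C (kquot (F X)) (@completion_at_fun X) (@completion_at_zmod X).
HB.instance Definition _ X := GRing.isMonoidMorphism.Build
  C (kquot (F X)) (@completion_at_fun X) (@completion_at_monoid X).

Definition completion_at X : khom C (kquot (F X)) :=
  @KHom K C (kquot (F X)) (@completion_at_fun X) (fun=> erefl).

Lemma completionP x y : (forall X, completion_at X x = completion_at X y) -> x = y.
Proof.
by move=> xy; apply: val_inj; apply: functional_extensionality_dep => X; apply: xy.
Qed.

Lemma completion_at_of X a : completion_at X (completion_of F a) = kproj (F X) a.
Proof. by []. Qed.

Lemma completion_repr x X Y : X%:num <= Y%:num ->
  exists a, completion_at X x = kproj (F X) a /\ completion_at Y x = kproj (F Y) a.
Proof. exact: (elimT (subalg_predP _ _) (subalg_valP x)). Qed.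

Lemma completion_of_zmod : zmod_morphism (completion_of F).
Proof.
by move=> a b; apply: completionP => X; rewrite rmorphB !completion_at_of rmorphB.
Qed.

Lemma completion_of_monoid : monoid_morphism (completion_of F).
Proof.
split=> [|a b]; apply: completionP => X.
  by rewrite rmorph1 completion_at_of rmorph1.
by rewrite rmorphM !completion_at_of rmorphM.
Qed.

HB.instance Definition _ :=
  GRing.isZmodMorphism.Build A C (completion_of F) completion_of_zmod.
HB.instance Definition _ :=
  GRing.isMonoidMorphism.Build A C (completion_of F) completion_of_monoid.

Lemma completion_of_scal a : completion_of F (kscal A a) = kscal C a.
Proof. exact: completionP. Qed.

Definition completion_in : khom A C :=
  @KHom K A C (completion_of F) completion_of_scal.

(** The limit takes at each [X] the stable value of the sequence there. For [X <= Y] both stable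
    values are read off a single term of the sequence, whose components share a representative. *)
Lemma completion_cauchy (k : nat -> C) (N : {posnum rat} -> nat) :
  (forall X n, (N X <= n)%N -> completion_at X (k n.+1) = completion_at X (k n)) ->
  exists x, forall X n, (N X <= n)%N -> completion_at X x = completion_at X (k n).
Proof.
move=> kN.
have kE X n : (N X <= n)%N ->
    completion_at X (k n) = completion_at X (k (N X)).
  elim: n => [|n IHn]; first by rewrite leqn0 => /eqP->.
  by rewrite leq_eqVlt => /predU1P[<- //|]; rewrite ltnS => Nn; rewrite kN // IHn.
have c : compatible F (fun X => completion_at X (k (N X))).
  move=> X Y XY; have [a [aX aY]] := completion_repr (k (maxn (N X) (N Y))) XY.
  by exists a; rewrite -(kE X (maxn (N X) (N Y))) ?leq_maxl //
       -(kE Y (maxn (N X) (N Y))) ?leq_maxr.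
by exists (subalg_in c) => X n Nn; rewrite kE.
Qed.

End CompletionTheory.
Arguments completion_at {K A F} X.

Section CompletionLift.
Variables (K : fieldType) (A B : kalg K).
Variables (F : {posnum rat} -> ideal A) (H : {posnum rat} -> ideal B).
(** The family need not come from a morphism [A -> B]: evaluating a power series makes sense only
    modulo each step of the filtration. *)
Variable u : forall X, khom A (kquot (H X)).
Hypothesis uF : forall X a, F X a -> u X a = 0.
Hypothesis u_compatible : forall (X Y : {posnum rat}) a, X%:num <= Y%:num ->
  exists b, u X a = kproj (H X) b /\ u Y a = kproj (H Y) b.

Lemma completion_lift : exists phi : khom (completion F) (completion H),
  (forall X x, completion_at X x = 0 -> completion_at X (phi x) = 0) /\
  (forall X a, completion_at X (phi (completion_of F a)) = u X a).
Proof.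
pose v X : khom (kquot (F X)) (kquot (H X)) := klift (@uF X).
have vE X a : v X (kproj (F X) a) = u X a by apply: qlift_proj.
have c x : compatible H (fun X => v X (completion_at X x)).
  move=> X Y XY; have [a [-> ->]] := completion_repr x XY.
  have [b [uX uY]] := u_compatible a XY.
  by exists b; rewrite !vE.
pose phi x : completion H := subalg_in (c x).
have phiE X x : completion_at X (phi x) = v X (completion_at X x) by [].
have Z : zmod_morphism phi.
  by move=> x y; apply: completionP => X; rewrite rmorphB !phiE !rmorphB.
have M : monoid_morphism phi.
  split=> [|x y]; apply: completionP => X; first by rewrite phiE !rmorph1.
  by rewrite rmorphM !phiE !rmorphM.
pose phir := HB.pack_for {rmorphism completion F -> completion H} phi
  (GRing.isZmodMorphism.Build _ _ _ Z) (GRing.isMonoidMorphism.Build _ _ _ M).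
have S a : phir (kscal _ a) = kscal _ a.
  by apply: completionP => X; rewrite phiE !khom_scal.
exists (KHom S); split=> [X x x0|X a]; last by rewrite [LHS]phiE vE.
by rewrite [LHS]phiE x0 rmorph0.
Qed.

End CompletionLift.

(** * The filtration of the path ring by weight *)

Section PathRing.
Variables (K : fieldType) (d e : nat) (f g : {poly K}).
Hypothesis hde : (1 <= e < d)%N.
Local Notation A := (path_ring d e f g).
Local Notation F := (path_filtration d e f g).
Local Notation r := (d%:R / e%:R : rat).

Lemma ratio_gt1 : 1 < r.
Proof. by case/andP: hde => e0 ed; rewrite ltr_pdivlMr ?ltr0n // mul1r ltr_nat. Qed.

(** Since [r > 1], each variable has weight at least 1. Hence large degree forces large weight,
    which yields the nilpotency bounds for evaluation modulo a given weight. *)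
Lemma mdeg_weight n (m : 'X_{1..n}) : (mdeg m)%:R <= weight d e m.
Proof.
rewrite mdegE natr_sum; apply: ler_sum => i _.
by rewrite ler_peMr // exprn_ege1 // ltW // ratio_gt1.
Qed.

Lemma path_filtrationP (X : {posnum rat}) (a : path_limit d e f g) :
  F X a <-> exists N, forall n, (N <= n)%N ->
    exists p, a = dirlim_in (path_trans d e f g) n (kproj _ p) /\
              weight_gt d e X%:num p.
Proof.
split=> [/dirlim_idealP[N aN]|[N aN]].
  by exists N => n /aN[x [-> [p [pX ->]]]]; exists p.
apply/dirlim_idealP; exists N => n /aN[p [-> pX]].
by exists (kproj _ p); split=> //; exists p.
Qed.

Lemma weight_gt_le n X Y (p : pseries K n) :
  X <= Y -> weight_gt d e Y p -> weight_gt d e X p.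
Proof. by move=> XY pY m /pY; apply: le_lt_trans. Qed.

Lemma weight_gtM n X Y (p q : kpseries K n) :
  weight_gt d e X p -> weight_gt d e Y q -> weight_gt d e (X + Y) (p * q).
Proof.
move=> pX qY m; rewrite psM => pq0.
have /hasP[k] : has (fun k => p k * q (m - k)%MM != 0) (mnm_below m).
  apply: contraNT pq0 => /hasPn pq0; rewrite big1_seq // => k /andP[_ km].
  by apply/eqP; have := pq0 k km; rewrite negbK.
rewrite mem_mnm_below => km; rewrite mulf_eq0 negb_or => /andP[/pX Xk /qY Yk].
by rewrite -(submK km) weightD [ltRHS]addrC ltrD.
Qed.

Lemma filtration_le (X Y : {posnum rat}) a : X%:num <= Y%:num -> F Y a -> F X a.
Proof.
move=> XY /path_filtrationP[N aN]; apply/path_filtrationP; exists N => n /aN[p [-> pY]].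
by exists p; split=> //; apply: weight_gt_le pY.
Qed.

Lemma filtrationM (X Y Z : {posnum rat}) a b : Z%:num <= X%:num + Y%:num ->
  F X a -> F Y b -> F Z (a * b).
Proof.
move=> ZXY /path_filtrationP[N aN] /path_filtrationP[M bM]; apply/path_filtrationP.
exists (maxn N M) => n; rewrite geq_max => /andP[/aN[p [-> pX]] /bM[q [-> qY]]].
exists (p * q); rewrite !rmorphM; split=> //.
exact: weight_gt_le ZXY (weight_gtM pX qY).
Qed.

(** Replacing [w_i] by [w_(i+1)] multiplies every weight by [r]. This gain, sharper than mere
    preservation of the filtration, makes the Newton step contract. *)
Lemma weight_gt_shift n X (p : pseries K n.+1) :
  weight_gt d e X p -> weight_gt d e (r * X) (ps_rename (@hi_inj n) p).
Proof.
move=> pX k; rewrite /ps_rename; case: ifP; last by rewrite eqxx.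
move=> _ /pX; have r0 : 0 < r := lt_trans ltr01 ratio_gt1.
rewrite -(ltr_pM2l r0) => /lt_le_trans; apply.
rewrite /weight [leRHS]big_ord_recl mulr_sumr /= -[leLHS]add0r lerD //.
by apply: ler_sum => i _; rewrite mnmE mulrCA exprS.
Qed.

Lemma filtration_shift (X Y : {posnum rat}) a : Y%:num <= r * X%:num ->
  F X a -> F Y (path_limit_shift d e f g a).
Proof.
move=> YX /path_filtrationP[N aN]; apply/path_filtrationP.
exists N.+1 => -[//|n]; rewrite ltnS => /aN[p [-> pX]].
exists (ps_rename (@hi_inj n) p); split.
  by rewrite [LHS]shift_dirlim_in /path_step kquot_mapE.
exact: weight_gt_le YX (weight_gt_shift pX).
Qed.

(** The steps of the filtration are defined by strict inequalities, so weight at least [c] means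
    vanishing modulo every step [X < c]. As [X] is positive, the condition is empty for [c <= 0]. *)
Definition wt_ge (c : rat) (x : A) :=
  forall X : {posnum rat}, X%:num < c -> completion_at X x = 0.

Lemma wt_ge_pos c x : (0 < c -> wt_ge c x) -> wt_ge c x.
Proof. by move=> cx X Xc; apply: cx => //; apply: lt_trans Xc. Qed.

Lemma wt_ge0 x : wt_ge 0 x.
Proof. by apply: wt_ge_pos; rewrite ltxx. Qed.

Lemma wt_ge_le c c' x : c <= c' -> wt_ge c' x -> wt_ge c x.
Proof. by move=> cc' xc' X Xc; apply/xc'/lt_le_trans/cc'. Qed.

Lemma wt_geB c x y : wt_ge c x -> wt_ge c y -> wt_ge c (x - y).
Proof. by move=> xc yc X Xc; rewrite rmorphB xc ?yc ?subr0. Qed.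

Lemma wt_geM a b x y : wt_ge a x -> wt_ge b y -> wt_ge (a + b) (x * y).
Proof.
move=> xa yb Z Zab; rewrite rmorphM.
have [Za|aZ] := ltP Z%:num a; first by rewrite xa ?mul0r.
have [Zb|bZ] := ltP Z%:num b; first by rewrite yb ?mulr0.
(* The slack [a + b - Z] is split evenly, giving [X < a] and [Y < b] with [X + Y = Z]. As [a] and
   [b] are at most [Z], both [X] and [Y] are positive and at most [Z]. *)
have a0 : 0 < a - (a + b - Z%:num) / 2 by lra.
have b0 : 0 < b - (a + b - Z%:num) / 2 by lra.
pose X := PosNum a0; pose Y := PosNum b0.
have XZ : X%:num <= Z%:num by rewrite /=; lra.
have YZ : Y%:num <= Z%:num by rewrite /=; lra.
(* [x'] represents [x] both modulo [Z] and modulo [X], where [x] vanishes, so it lies in [F X];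
   likewise [y'] lies in [F Y]. *)
have [x' [xX ->]] := completion_repr x XZ; have [y' [yY ->]] := completion_repr y YZ.
rewrite -rmorphM -(rmorph0 (kproj _)); apply: qproj_eq; rewrite subr0.
have memF W z : kproj (F W) z = 0 -> F W z.
  by rewrite -(rmorph0 (kproj _)) => /qproj_inj; rewrite subr0.
apply: (@filtrationM X Y).
- by rewrite /=; lra.
- by apply: memF; rewrite -xX xa //=; lra.
- by apply: memF; rewrite -yY yb //=; lra.
Qed.

Lemma wt_ge_sep x : (forall n : nat, wt_ge n%:R x) -> x = 0.
Proof.
move=> xn; apply: completionP => X; rewrite rmorph0; apply: (xn (Num.bound X%:num)).
exact: archi_boundP.
Qed.

(** Modulo step [X] the sequence is constant once [n * delta > X], so [completion_cauchy]
    applies. *)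
Lemma wt_ge_cauchy (delta : rat) (k : nat -> A) : 0 < delta ->
  (forall n, wt_ge (n%:R * delta) (k n.+1 - k n)) ->
  exists x, forall n, wt_ge (n%:R * delta) (x - k n).
Proof.
move=> delta0 kd; pose N (X : {posnum rat}) := Num.bound (X%:num / delta).
have NX X n : (N X <= n)%N -> X%:num < n%:R * delta.
  move=> Nn; rewrite -ltr_pdivrMr //; apply: lt_le_trans (archi_boundP _) _.
    by rewrite divr_ge0 // ltW.
  by rewrite ler_nat.
have [|x xk] := @completion_cauchy _ _ F k N.
  by move=> X n /NX Xn; apply/eqP; rewrite -subr_eq0 -rmorphB kd.
exists x => n X Xn.
have kn m : (n <= m)%N -> completion_at X (k m) = completion_at X (k n).
  elim: m => [|m IHm]; first by rewrite leqn0 => /eqP->.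
  rewrite leq_eqVlt => /predU1P[<- //|]; rewrite ltnS => nm; rewrite -IHm //.
  apply/eqP; rewrite -subr_eq0 -rmorphB kd // (lt_le_trans Xn) //.
  by rewrite ler_pM2r // ler_nat.
by rewrite rmorphB (xk X (maxn (N X) n)) ?leq_maxl // kn ?leq_maxr // subrr.
Qed.

Lemma completion_at_shiftE X x :
  completion_at X (path_shift f g hde x) =
  kquot_map (@path_limit_shift_filtration _ _ _ f g hde X) (completion_at X x).
Proof. by []. Qed.

Lemma completion_at_shift X x :
  completion_at X x = 0 -> completion_at X (path_shift f g hde x) = 0.
Proof.
by move=> x0; rewrite completion_at_shiftE x0 rmorph0.
Qed.

Lemma wt_ge_shift c x : wt_ge c x -> wt_ge (r * c) (path_shift f g hde x).
Proof.
move=> xc X Xrc; have r0 : 0 < r := lt_trans ltr01 ratio_gt1.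
(* At level [X / r < c] the element vanishes, and [X / r <= X] lets one representative serve both
   levels. *)
have Y0 : 0 < X%:num / r by rewrite divr_gt0.
pose Y := PosNum Y0; have YX : Y%:num <= X%:num.
  by rewrite /= ler_pdivrMr // ler_peMr // ltW // ratio_gt1.
have [a [aY aX]] := completion_repr x YX.
rewrite completion_at_shiftE aX kquot_mapE -(rmorph0 (kproj _)); apply: qproj_eq; rewrite subr0.
apply: (@filtration_shift Y); first by rewrite /= mulrC divfK // gt_eqF.
rewrite -[a]subr0; apply: qproj_inj; rewrite -[LHS]aY xc ?rmorph0 //=.
by rewrite ltr_pdivrMr // mulrC.
Qed.

Lemma coord_seq_in i n : (i <= n)%N ->
  dirlim_of (coord_seq_coherent d e f g i) =
  dirlim_in (path_trans d e f g) n (kproj _ (ps_var K (inord i))).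
Proof.
move=> ni; rewrite (@dirlim_of_in _ _ _ n) /coord_seq ?ni // => k nk.
have ik := leq_trans ni nk.
rewrite (leqW ik) ik /path_trans kquot_mapE.
rewrite kps_rename_var; congr (kproj _ (ps_var _ _)).
by apply: val_inj; rewrite /= !inordK // ltnS // leqW.
Qed.

Lemma wt_ge_coord i : wt_ge (r ^+ i) (Defs.coord d e f g i).
Proof.
move=> X Xi; rewrite completion_at_of -(rmorph0 (kproj _)).
apply: qproj_eq; rewrite subr0; apply/path_filtrationP; exists i => n ni.
exists (ps_var K (inord i)); split; first exact: coord_seq_in.
move=> m; rewrite /ps_var; have [->|_] := eqVneq m; last by rewrite eqxx.
move=> _; rewrite /weight (bigD1 (inord i)) //= mnm1E eqxx mul1r inordK //.
rewrite big1 ?addr0 // => j /negbTE ji.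
by rewrite mnm1E eq_sym ji mul0r.
Qed.

End PathRing.

(** * The fixed point equation for changes of coordinate *)

(** What the fixed point argument uses: [W c x] reads as weight at least [c], the filtration is
    multiplicative, separated and complete, and [s] multiplies weights by [r]. *)
Record weighted (K : fieldType) (A : kalg K) (r : rat) (s : khom A A)
    (W : rat -> A -> Prop) := Weighted {
  weighted_all : forall x, W 0 x;
  weighted0 : forall c, W c 0;
  weighted_le : forall c c' x, c <= c' -> W c' x -> W c x;
  weightedB : forall c x y, W c x -> W c y -> W c (x - y);
  weightedM : forall a b x y, W a x -> W b y -> W (a + b) (x * y);
  weighted_sep : forall x, (forall n : nat, W n%:R x) -> x = 0;
  weighted_cauchy : forall (delta : rat) (k : nat -> A), 0 < delta ->
    (forall n, W (n%:R * delta) (k n.+1 - k n)) ->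
    exists x, forall n, W (n%:R * delta) (x - k n);
  weighted_shift : forall c x, W c x -> W (r * c) (s x)
}.

(** Differences of equal powers are divisible by [y - y']; hence [recip] does not lower the weight
    of a difference. *)
Lemma recip_sub (K : fieldType) (A : kalg K) k (p : {poly K}) (y y' : A) :
  exists t, recip k p y - recip k p y' = (y - y') * t.
Proof.
exists (\sum_(j < k.+1) kscal A p`_j *
  \sum_(i < k - j) y ^+ ((k - j).-1 - i) * y' ^+ i).
rewrite /recip -sumrB mulr_sumr; apply: eq_bigr => j _.
by rewrite -mulrBr subrXX mulrCA.
Qed.

Lemma recip0 (K : fieldType) (A : kalg K) k (p : {poly K}) :
  p \is monic -> size p = k.+1 -> recip k p (0 : A) = 1.
Proof.
move=> /monicP; rewrite /lead_coef => + pk; rewrite pk /= => pk1.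
rewrite /recip big_ord_recr /= subnn expr0 mulr1 pk1 rmorph1 big1 ?add0r // => j _.
by rewrite expr0n subn_eq0 leqNgt ltn_ord mulr0.
Qed.

Section Contraction.
Variables (K : fieldType) (A : kalg K) (r : rat) (s : khom A A).
Variable W : rat -> A -> Prop.
Hypotheses (hW : weighted r s W) (r1 : 1 < r).

Let WB := weightedB hW.

Lemma weightedN c x : W c x -> W c (- x).
Proof.
move=> xc; rewrite -sub0r -[X in X - _](subrr x).
by apply: WB => //; apply: WB.
Qed.

Lemma weightedD c x y : W c x -> W c y -> W c (x + y).
Proof. by move=> xc yc; rewrite -[y]opprK; apply: WB => //; apply: weightedN. Qed.

Lemma weighted_mull c x y : W c y -> W c (x * y).
Proof.
move=> yc; rewrite -[c]add0r; apply: (weightedM hW) => //.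
exact: (weighted_all hW).
Qed.

Lemma weighted_mulr c x y : W c x -> W c (x * y).
Proof. by rewrite mulrC; apply: weighted_mull. Qed.

Definition one_unit (u : A) := W 1 (u - 1).

Lemma one_unitM u v : one_unit u -> one_unit v -> one_unit (u * v).
Proof.
move=> u1 v1; rewrite /one_unit (_ : u * v - 1 = (u - 1) * v + (v - 1)); last ring.
by apply: weightedD => //; apply: weighted_mulr.
Qed.

(** From [x = - (u - 1) * x], weight at least [n] implies weight at least [n + 1], and separatedness
    concludes. *)
Lemma one_unit_cancel u x : one_unit u -> u * x = 0 -> x = 0.
Proof.
move=> u1 ux; apply: (weighted_sep hW); elim=> [|n IHn]; first exact: (weighted_all hW).
have -> : x = - ((u - 1) * x) by rewrite mulrBl ux mul1r sub0r opprK.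
by apply: weightedN; rewrite -natr1 addrC; apply: (weightedM hW).
Qed.

Lemma recip_contract c k p y y' :
  W c (y - y') -> W c (recip k p y - recip k p y').
Proof. by have [t ->] := recip_sub k p y y'; apply: weighted_mulr. Qed.

Lemma one_unit1 : one_unit 1.
Proof. by rewrite /one_unit subrr; apply: weighted0 hW _. Qed.

Lemma one_unitX u n : one_unit u -> one_unit (u ^+ n).
Proof.
by move=> u1; elim: n => [|n IHn]; rewrite ?exprS; [exact: one_unit1|apply: one_unitM].
Qed.

Lemma one_unit_recip k p y :
  p \is monic -> size p = k.+1 -> W 1 y -> one_unit (recip k p y).
Proof.
move=> pm pk y1; rewrite /one_unit -(recip0 A pm pk).
by apply: recip_contract; rewrite subr0.
Qed.

Lemma weighted_shift_le c x : 0 <= c -> W c x -> W c (s x).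
Proof.
move=> c0 /(weighted_shift hW); apply: (weighted_le hW).
by rewrite ler_peMl // ltW.
Qed.

Lemma one_unit_shift u : one_unit u -> one_unit (s u).
Proof.
by move=> u1; rewrite /one_unit -(rmorph1 s) -rmorphB; apply: weighted_shift_le.
Qed.

(** * The Newton step and its fixed points *)

Section Equation.
Variables (d e : nat) (f g f' g' : {poly K}).
Hypotheses (fm : f \is monic) (gm : g \is monic).
Hypotheses (f'm : f' \is monic) (g'm : g' \is monic).
Hypotheses (fd : size f = d.+1) (ge : size g = e.+1).
Hypotheses (f'd : size f' = d.+1) (g'e : size g' = e.+1).
Hypothesis d0 : (d%:R : K) != 0.
Variable (w : A).
Hypothesis w1 : W 1 w.

(* The condition for [w * k] to satisfy the relation given by [f'] and [g'],
   stripped of the factor [w ^+ d] by means of the relation between [w] and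
   [s w] given by [f] and [g]. *)
Definition change_eq k :=
  k ^+ d * (recip d f w * recip e g' (s (w * k))) =
  recip e g (s w) * recip d f' (w * k) * s k ^+ e.

Local Notation U k := (recip d f w * recip e g' (s (w * k))).
Local Notation V k := (recip e g (s w) * recip d f' (w * k) * s k ^+ e).

(** Newton's method with the derivative frozen at [d]. To first order only [k ^+ d] varies: [U] and
    [V] depend on [k] through [w * k] and [s k], which gain weight. *)
Definition newton k : A := k - kscal A d%:R^-1 * (k ^+ d * U k - V k).

Lemma newton_fixed k : newton k = k <-> change_eq k.
Proof.
rewrite /newton /change_eq; split=> [kk|->]; last by rewrite subrr mulr0 subr0.
apply/eqP; rewrite -subr_eq0; move: kk; set E := k ^+ d * _ - _ => kk.
have Ed : kscal A d%:R^-1 * E = 0.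
  by rewrite -[LHS](subKr k) kk subrr.
by rewrite -[E]mul1r -(rmorph1 (kscal A)) -(divff d0) rmorphM -mulrA Ed mulr0.
Qed.

Lemma w_mul1 k : W 1 (w * k).
Proof. exact: weighted_mulr. Qed.

Lemma sw_mul1 k : W 1 (s (w * k)).
Proof. exact/weighted_shift_le/w_mul1. Qed.

Lemma sw1 : W 1 (s w).
Proof. exact: weighted_shift_le. Qed.

Lemma U_unit k : one_unit (U k).
Proof. by apply: one_unitM; apply: one_unit_recip => //; apply: sw_mul1. Qed.

Lemma V_unit k : one_unit k -> one_unit (V k).
Proof.
move=> k1; apply: one_unitM; last exact/one_unitX/one_unit_shift.
by apply: one_unitM; apply: one_unit_recip => //; [apply: sw1|apply: w_mul1].
Qed.

Lemma newton_unit k : one_unit k -> one_unit (newton k).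
Proof.
move=> k1; rewrite /one_unit /newton addrAC; apply: WB => //; apply: weighted_mull.
have -> : k ^+ d * U k - V k = (k ^+ d * U k - 1) - (V k - 1) by ring.
apply: WB; last exact: V_unit.
by apply: one_unitM; [apply: one_unitX|apply: U_unit].
Qed.

(** The gain of one step: factors [w] and [u - 1], for a 1-unit [u], have weight at least 1, and the
    shift takes weight [c >= 1] to [r * c >= c + (r - 1)]. *)
Let delta := Num.min 1 (r - 1).
Let delta0 : 0 < delta. Proof. by rewrite lt_min ltr01 subr_gt0. Qed.
Let delta1 : delta <= 1. Proof. by rewrite ge_min lexx. Qed.
Let delta_r : delta <= r - 1. Proof. by rewrite ge_min lexx orbT. Qed.

(** The first-order part cancels, since [k ^+ d - k' ^+ d = (k - k') * S] with [S] congruent to [d].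
    Each of the three remaining terms gains at least [delta]. *)
Lemma newton_contract c k k' : 1 <= c -> one_unit k -> one_unit k' ->
  W c (k - k') -> W (c + delta) (newton k - newton k').
Proof.
move=> c1 k1 k'1 kk'.
pose S := \sum_(i < d) k ^+ (d.-1 - i) * k' ^+ i.
have kd : k ^+ d - k' ^+ d = (k - k') * S by rewrite subrXX.
have dE : kscal A d%:R^-1 * d%:R = 1.
  by rewrite -(rmorph_nat (kscal A)) -rmorphM mulVf // rmorph1.
have -> : newton k - newton k' = - (kscal A d%:R^-1 *
   ((k - k') * (S * U k - d%:R) + k' ^+ d * (U k - U k') - (V k - V k'))).
  rewrite /newton.
  have -> : (k - k') * (S * U k - d%:R) = (k ^+ d - k' ^+ d) * U k - (k - k') * d%:R.
    by rewrite kd; ring.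
  transitivity ((kscal A d%:R^-1 * d%:R) * (k - k')
    - kscal A d%:R^-1 * (k ^+ d * U k - V k - (k' ^+ d * U k' - V k'))); last by ring.
  rewrite dE; ring.
apply: weightedN; apply: weighted_mull; apply: WB; first apply: weightedD.
(* [S] is a sum of [d] products of 1-units and [U k] is a 1-unit, so [S * U k - d] has weight at
   least 1. *)
- apply: (weightedM hW) => //; apply: (weighted_le hW delta1).
  have -> : S * U k - d%:R = S * (U k - 1) + (S - d%:R) by ring.
  apply: weightedD; first exact/weighted_mull/U_unit.
  rewrite -[d in d%:R](card_ord d) -sumr_const -sumrB.
  elim/big_ind: _ => [|x y|i _]; [exact: (weighted0 hW)|exact: weightedD|].
  by apply: one_unitM; apply: one_unitX.
(* [U] involves [k] only through [s (w * k)]; the factor [w] brings the gain. *)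
- apply: weighted_mull; rewrite -mulrBr; apply: weighted_mull.
  apply: recip_contract; rewrite -rmorphB -mulrBr.
  apply: (weighted_le hW (c' := 1 + c)); first by move: delta1; lra.
  by apply: weighted_shift_le; [move: c1; lra|apply: (weightedM hW)].
(* In [V] the factor [recip d f' (w * k)] gains through [w], and [s k ^+ e] through the shift. *)
- have -> : V k - V k' = recip e g (s w) *
      ((recip d f' (w * k) - recip d f' (w * k')) * s k ^+ e
       + recip d f' (w * k') * (s k ^+ e - s k' ^+ e)) by ring.
  apply: weighted_mull; apply: weightedD; [apply: weighted_mulr|apply: weighted_mull].
    apply: recip_contract; rewrite -mulrBr.
    by apply: (weighted_le hW (c' := 1 + c)); [move: delta1; lra|apply: (weightedM hW)].
  rewrite subrXX; apply: weighted_mulr; rewrite -rmorphB.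
  apply: (weighted_le hW (c' := r * c)); last exact: (weighted_shift hW).
  have : 0 <= (r - 1) * (c - 1) by rewrite mulr_ge0 ?subr_ge0 // ltW.
  by move: delta_r; lra.
Qed.

Lemma change_eq_uniq k k' : one_unit k -> one_unit k' ->
  change_eq k -> change_eq k' -> k = k'.
Proof.
move=> k1 k'1 /newton_fixed kE /newton_fixed k'E; apply/eqP; rewrite -subr_eq0.
apply/eqP/(weighted_sep hW) => N.
pose n := Num.bound (N%:R / delta).
have Nn : N%:R <= n%:R * delta.
  by rewrite -ler_pdivrMr // ltW // archi_boundP // divr_ge0 // ltW.
(* The induction runs over weights [1 + n * delta] because contraction requires weight at least 1;
   two 1-units start with a difference of weight 1. *)
apply: (weighted_le hW (c' := 1 + n%:R * delta)); first by lra.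
elim: {Nn}n => [|n IHn].
  have -> : k - k' = (k - 1) - (k' - 1) by ring.
  by rewrite mul0r addr0; apply: WB.
rewrite -kE -k'E -natr1 mulrDl mul1r addrA; apply: newton_contract => //.
by rewrite lerDl mulr_ge0 // ltW.
Qed.

Lemma change_eq_ex : exists2 k, one_unit k & change_eq k.
Proof.
pose k n := iter n newton 1.
have k1 n : one_unit (k n).
  by elim: n => [|n IHn]; [exact: one_unit1|exact: newton_unit].
have kS n : W (1 + n%:R * delta) (k n.+1 - k n).
  elim: n => [|n IHn]; first by rewrite mul0r addr0; apply: newton_unit one_unit1.
  rewrite -natr1 mulrDl mul1r addrA; apply: newton_contract (k1 n.+1) (k1 n) IHn.
  by rewrite lerDl mulr_ge0 // ltW.
have [x xk] : exists x, forall n, W (n%:R * delta) (x - k n).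
  apply: (weighted_cauchy hW) => // n; apply: (weighted_le hW) (kS n).
  by rewrite lerDr.
have bd N : N%:R <= (Num.bound (N%:R / delta))%:R * delta.
  by rewrite -ler_pdivrMr // ltW // archi_boundP // divr_ge0 // ltW.
have x1 : one_unit x.
  rewrite /one_unit -(subrKA (k (Num.bound (1%:R / delta)))).
  apply: weightedD (k1 _); exact: (weighted_le hW (bd 1%N) (xk _)).
exists x => //; apply/newton_fixed/eqP; rewrite -subr_eq0; apply/eqP.
apply: (weighted_sep hW) => N.
(* Large enough that [x - k n] has both weight at least 1, as contraction requires, and weight at
   least [N]. *)
pose n := (Num.bound (1%:R / delta) + Num.bound (N%:R / delta))%N.
have n1 : 1 <= n%:R * delta.
  by rewrite (le_trans (bd 1%N)) // ler_pM2r // ler_nat leq_addr.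
have nN : N%:R <= n%:R * delta.
  by rewrite (le_trans (bd N)) // ler_pM2r // ler_nat leq_addl.
have -> : newton x - x = (newton x - newton (k n)) - (x - k n.+1).
  by rewrite -[k n.+1]/(newton (k n)); ring.
apply: (weighted_le hW (c' := n.+1%:R * delta)).
  by rewrite -natr1; move: delta0; lra.
apply: WB; last exact: xk.
by rewrite -natr1 mulrDl mul1r; apply: newton_contract (xk n).
Qed.

(** After multiplication by the 1-unit [recip d f w], the equation for [k] and the relation for [w]
    identify the two sides; the 1-unit is then cancelled. *)
Lemma change_eq_rel k :
  w ^+ d * recip e g (s w) = s w ^+ e * recip d f w -> change_eq k ->
  (w * k) ^+ d * recip e g' (s (w * k)) = s (w * k) ^+ e * recip d f' (w * k).
Proof.
rewrite /change_eq => rel kE; apply/eqP; rewrite -subr_eq0; apply/eqP.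
have fu : one_unit (recip d f w) by apply: one_unit_recip.
apply: (one_unit_cancel fu).
have -> : s (w * k) ^+ e = s w ^+ e * s k ^+ e by rewrite rmorphM exprMn.
rewrite exprMn.
set t := recip e g' _ in kE *; set t' := recip d f' _ in kE *.
transitivity (w ^+ d * (k ^+ d * (recip d f w * t))
  - (s w ^+ e * recip d f w) * t' * s k ^+ e); first by ring.
by rewrite kE -rel; ring.
Qed.

End Equation.

Lemma change_eq1 d e f g w : change_eq d e f g f g w 1.
Proof. by rewrite /change_eq rmorph1 mulr1 !expr1n mul1r mulr1 mulrC. Qed.

(** A cocycle rule: in the product of the two equations the factors of [f'] and [g'] appear on both
    sides and form a 1-unit, which cancels. *)
Lemma change_eq_mul d e f g f' g' f'' g'' w k l :
  f' \is monic -> g' \is monic -> size f' = d.+1 -> size g' = e.+1 -> W 1 w ->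
  change_eq d e f g f' g' w k -> change_eq d e f' g' f'' g'' (w * k) l ->
  change_eq d e f g f'' g'' w (k * l).
Proof.
move=> f'm g'm f'd g'e w1; rewrite /change_eq -mulrA => kE lE.
have u1 : one_unit (recip d f' (w * k) * recip e g' (s (w * k))).
  apply: one_unitM; apply: one_unit_recip => //; first exact: weighted_mulr.
  by apply: weighted_shift_le => //; apply: weighted_mulr.
apply/eqP; rewrite -subr_eq0; apply/eqP/(one_unit_cancel u1).
move: kE lE; rewrite !mulrA [s (k * l)]rmorphM !exprMn.
set p := recip d f' _; set p' := recip d f'' _.
set q := recip e g' _; set q' := recip e g'' _ => kE lE.
transitivity ((k ^+ d * recip d f w * q) * (l ^+ d * p * q')
  - (recip e g (s w) * p * s k ^+ e) * (q * p' * s l ^+ e)); first by ring.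
by rewrite kE lE subrr.
Qed.

End Contraction.

Lemma change_eq_khom (K : fieldType) (A B : kalg K) (s : khom A A) (t : khom B B)
    (phi : khom A B) d e f g f' g' w k :
  (forall x, phi (s x) = t (phi x)) -> change_eq s d e f g f' g' w k ->
  change_eq t d e f g f' g' (phi w) (phi k).
Proof.
move=> st /(congr1 phi).
by rewrite /change_eq !rmorphM !rmorphXn !recip_khom !st !rmorphM !st.
Qed.

(** * Filtered morphisms between path rings *)

Section PathRingMaps.
Variables (K : fieldType) (d e : nat).
Hypothesis hde : (1 <= e < d)%N.
Local Notation r := (d%:R / e%:R : rat).
Local Notation shift f g := (path_shift f g hde).
Local Notation filtered phi :=
  (forall X x, completion_at X x = 0 -> completion_at X (phi x) = 0).

Lemma path_ring_weighted (f g : {poly K}) :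
  weighted r (shift f g) (@wt_ge K d e f g).
Proof.
split.
- exact: wt_ge0.
- by move=> c X _; rewrite rmorph0.
- exact: wt_ge_le.
- exact: wt_geB.
- exact: wt_geM.
- exact: wt_ge_sep.
- exact: wt_ge_cauchy.
- exact: wt_ge_shift.
Qed.

Lemma coord_rel (f g : {poly K}) :
  let w := Defs.coord d e f g 0 in
  w ^+ d * recip e g (shift f g w) = shift f g w ^+ e * recip d f w.
Proof.
move=> w; rewrite path_shift_coord {}/w.
pose j := completion_in (path_filtration d e f g).
pose i := dirlim_in (path_trans d e f g) 1.
have cE k : (k <= 1)%N ->
    Defs.coord d e f g k = j (i (kproj _ (ps_var K (inord k)))).
  by move=> k1; rewrite /Defs.coord (coord_seq_in _ _ _ _ k1).
rewrite !cE //.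
pose phi : khom (kpseries K 2) (path_ring d e f g) := khom_comp j (khom_comp i (kproj _)).
apply/eqP; rewrite -subr_eq0; apply/eqP.
(* The difference is the image of the only relation of stage 1. *)
transitivity (phi (path_rel d e f g (ord0 : 'I_1))).
  rewrite /path_rel rmorphB !rmorphM !rmorphXn !recip_khom /=.
  rewrite (_ : widen_ord _ _ = inord 0); last by apply/val_inj; rewrite /= inordK.
  by rewrite (_ : lift _ _ = inord 1) //; apply/val_inj; rewrite /= inordK.
rewrite /phi /= (_ : qproj _ _ = 0) ?rmorph0 //.
rewrite -(rmorph0 (qproj _)); apply: qproj_eq; rewrite subr0.
exists (fun=> 1); rewrite big_ord1 mul1r //.
Qed.

Lemma wt_ge_prod (f g : {poly K}) n (x : nat -> path_ring d e f g) (m : 'X_{1..n}) :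
  (forall i, wt_ge (r ^+ i) (x i)) ->
  wt_ge (weight d e m) (\prod_(i < n) x i ^+ m i).
Proof.
move=> xr; have hW := path_ring_weighted f g.
rewrite /weight; elim/big_ind2: _ => [|a b c c'|i _]; first exact: weighted_all hW _.
  by move=> ba cc; rewrite addrC mulrC; apply: wt_geM.
rewrite mulrC; elim: (m i) => [|k IHk]; first by rewrite mulr0; apply: wt_ge0.
by rewrite exprSr -natr1 mulrDr mulr1; apply: wt_geM.
Qed.

Lemma completion_at_prod (f g : {poly K}) n (x : nat -> path_ring d e f g)
    (m : 'X_{1..n}) X :
  (forall i, wt_ge (r ^+ i) (x i)) -> X%:num < weight d e m ->
  \prod_(i < n) completion_at X (x i) ^+ m i = 0.
Proof.
move=> xr Xm; rewrite -(wt_ge_prod xr Xm) rmorph_prod.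
by apply: eq_bigr => i _; rewrite rmorphXn.
Qed.

Lemma bound_weight n (m : 'X_{1..n}) (X : {posnum rat}) :
  (Num.bound X%:num <= mdeg m)%N -> X%:num < weight d e m.
Proof.
move=> Xm; apply: lt_le_trans (mdeg_weight hde m).
by apply: lt_le_trans (archi_boundP _) _; rewrite ?ler_nat.
Qed.

(** * Filtered morphisms are determined by the coordinates *)

Section Uniqueness.
Variables (f g f' g' : {poly K}).
Local Notation A := (path_ring d e f g).
Local Notation A' := (path_ring d e f' g').

Lemma filtered_wt_ge (phi : khom A' A) c x :
  filtered phi -> wt_ge c x -> wt_ge c (phi x).
Proof. by move=> fphi xc X Xc; apply/fphi/xc. Qed.

(** Modulo step [X], a filtered morphism depends only on a power series representing [x] at a finite
    stage. The images of the coordinates are nilpotent there, so [kpseries_hom_uniq] applies. *)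
Lemma path_ring_hom_uniq (phi psi : khom A' A) : filtered phi -> filtered psi ->
  (forall i, phi (Defs.coord d e f' g' i) = psi (Defs.coord d e f' g' i)) ->
  phi =1 psi.
Proof.
move=> fphi fpsi phipsi x; apply: completionP => X.
have [a [xa _]] := completion_repr x (lexx X%:num).
pose j := completion_in (path_filtration d e f' g').
have redX (chi : khom A' A) : filtered chi ->
    completion_at X (chi x) = completion_at X (chi (j a)).
  move=> fchi; apply/eqP; rewrite -subr_eq0 -!rmorphB fchi //.
  by rewrite rmorphB xa subrr.
rewrite (redX phi) // (redX psi) // {redX}.
have [n /(_ n (leqnn n))[y ->]] := dirlim_in_surj a.
have [p ->] := qproj_surj y.
pose u (chi : khom A' A) : khom (kpseries K n.+1) (kquot (path_filtration d e f g X)) :=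
  khom_comp (completion_at X) (khom_comp chi (khom_comp j
    (khom_comp (dirlim_in _ n) (kproj _)))).
have uE chi (i : 'I_n.+1) :
    u chi (ps_var K i) = completion_at X (chi (Defs.coord d e f' g' i)).
  rewrite /Defs.coord (coord_seq_in _ _ _ _ (n := n)) ?inord_val //.
  by rewrite -ltnS.
apply: (@kpseries_hom_uniq _ _ _ (u phi) (u psi)
  (fun i => completion_at X (phi (Defs.coord d e f' g' i))) (Num.bound X%:num)).
- by move=> i; apply: uE.
- by move=> i; rewrite uE phipsi.
move=> m Xm; apply: (@completion_at_prod _ _ _ (fun i => phi (Defs.coord d e f' g' i))).
  by move=> i; apply: (filtered_wt_ge fphi); apply: wt_ge_coord.
exact: bound_weight.
Qed.

End Uniqueness.

(** * Filtered morphisms from solutions of the relations *)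

Section Existence.
Variables (f g f' g' : {poly K}).
Local Notation A := (path_ring d e f g).
Local Notation A' := (path_ring d e f' g').
Variable v : A.
Hypothesis v1 : wt_ge 1 v.
Hypothesis v_rel :
  v ^+ d * recip e g' (shift f g v) = shift f g v ^+ e * recip d f' v.

Let x i := iter i (shift f g) v.

Let wt_x i : wt_ge (r ^+ i) (x i).
Proof. by elim: i => [//|i IHi]; rewrite exprS; apply: wt_ge_shift. Qed.

Let x_rel i :
  x i ^+ d * recip e g' (x i.+1) = x i.+1 ^+ e * recip d f' (x i).
Proof.
elim: i => [//|i /(congr1 (shift f g))].
by rewrite !rmorphM !rmorphXn !recip_khom.
Qed.

Let nil n X (m : 'X_{1..n}) : (Num.bound X%:num <= mdeg m)%N ->
  \prod_(i < n) completion_at X (x i) ^+ m i = 0.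
Proof. by move=> Xm; apply: completion_at_prod => //; apply: bound_weight. Qed.

Let ev n X := kps_eval (@nil n.+1 X).

Let ev_rel n X p : ideal_span (@path_rel K d e f' g' n) p -> ev n X p = 0.
Proof.
move=> [c ->]; rewrite rmorph_sum big1 // => i _; rewrite rmorphM.
rewrite (_ : ev n X (path_rel _ _ _ _ i) = 0) ?mulr0 //.
rewrite rmorphB !rmorphM !rmorphXn !recip_khom !kps_eval_var.
set at_X := completion_at X; rewrite -!(recip_khom at_X) -!(rmorphXn at_X).
rewrite -!(rmorphM at_X) -(rmorphB at_X) -[RHS](rmorph0 at_X).
by congr (at_X _); apply/eqP; rewrite subr_eq0; apply/eqP/(x_rel i).
Qed.

Let evq n X : khom (path_quot d e f' g' n) (kquot (path_filtration d e f g X)) :=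
  klift (@ev_rel n X).

Let evq_proj n X p : evq n X (kproj _ p) = ev n X p.
Proof. exact: qlift_proj. Qed.

(** Both sides come from morphisms on power series with the same values on the variables. *)
Let evq_trans X n y : evq n.+1 X (path_trans d e f' g' n y) = evq n X y.
Proof.
have [p ->] := qproj_surj y; rewrite /path_trans kquot_mapE !evq_proj.
pose u := khom_comp (ev n.+1 X) (kps_rename K (@lo_inj n)).
apply: (@kpseries_hom_uniq _ _ _ u (ev n X) (fun i => completion_at X (x i))
  (Num.bound X%:num)) => [i|i|m /nil //]; last exact: kps_eval_var.
have -> : u (ps_var K i) = ev n.+1 X (ps_var K (widen_ord (leqnSn n.+1) i)).
  exact: congr1 (kps_rename_var _ _ i).
exact: kps_eval_var.
Qed.

Let evl X : khom (path_limit d e f' g') (kquot (path_filtration d e f g X)) :=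
  dirlim_lift (evq_trans X).

Let evl_in X n p : evl X (dirlim_in _ n (kproj _ p)) = ev n X p.
Proof. by rewrite [LHS]dirlim_lift_in evq_proj. Qed.

Let evl_filtration X a : path_filtration d e f' g' X a -> evl X a = 0.
Proof.
move=> /path_filtrationP[n /(_ n (leqnn n))[p [-> pX]]]; rewrite evl_in.
by apply: kps_eval_eq0 => m /pX Xm; apply: completion_at_prod.
Qed.

Let evl_compatible (X Y : {posnum rat}) a : X%:num <= Y%:num ->
  exists b, evl X a = kproj _ b /\ evl Y a = kproj _ b.
Proof.
move=> XY; have [b bY] := qproj_surj (evl Y a); exists b; split; last exact: bY.
have sub z : path_filtration d e f g Y z -> path_filtration d e f g X (khom_id _ z).
  exact: filtration_le.
(* [tr] is the projection from the quotient at [Y] to that at [X]; it carries evaluation modulo [Y]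
   to evaluation modulo [X]. *)
pose tr := kquot_map sub.
have trE z : tr (completion_at Y z) = completion_at X z.
  have [c [cX cY]] := completion_repr z XY.
  exact: etrans (congr1 tr cY) (etrans (kquot_mapE sub c) (esym cX)).
transitivity (tr (evl Y a)); last exact: etrans (congr1 tr bY) (kquot_mapE sub b).
have [n /(_ n (leqnn n))[y ->]] := dirlim_in_surj a.
have [p ->] := qproj_surj y; rewrite !evl_in.
apply: (@kpseries_hom_uniq _ _ _ (ev n X) (khom_comp tr (ev n Y))
  (fun i => completion_at X (x i)) (Num.bound X%:num)) => [i|i|m /nil //].
  exact: kps_eval_var.
exact: etrans (congr1 tr (kps_eval_var (@nil n.+1 Y) i)) (trE (x i)).
Qed.

(** The evaluations [w_i |-> s^i v] modulo each [X] respect relations, stages and filtration, and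
    agree for varying [X]; [completion_lift] assembles them. *)
Lemma path_ring_hom_ex : exists phi : khom A' A,
  filtered phi /\
  (forall i, phi (Defs.coord d e f' g' i) = iter i (shift f g) v).
Proof.
have [phi [fphi phiE]] := completion_lift evl_filtration evl_compatible.
exists phi; split=> // i; apply: completionP => X.
rewrite phiE (coord_seq_in _ _ _ _ (leqnn i)) evl_in kps_eval_var inordK //.
Qed.

End Existence.
End PathRingMaps.

(** * Isomorphism of path rings *)

Section ChangeOfCoordinate.
Variables (K : fieldType) (d e : nat).
Hypothesis hde : (1 <= e < d)%N.
Hypothesis d0 : (d%:R : K) != 0.
Local Notation r := (d%:R / e%:R : rat).
Local Notation shift f g := (path_shift f g hde).
Local Notation filtered phi :=
  (forall X x, completion_at X x = 0 -> completion_at X (phi x) = 0).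
Local Notation admissible f g :=
  [/\ f \is monic, g \is monic, size f = d.+1 & size g = e.+1].

Lemma wt_ge_coord0 (f g : {poly K}) : wt_ge 1 (Defs.coord d e f g 0).
Proof. exact: (@wt_ge_coord _ d e f g 0). Qed.

(** The morphism sends [w_i] to [s^i (w_0 k)], with [k] the solution of the change equation. Both
    composites with the shifts are filtered and agree on coordinates, hence equivariance. The data
    on [k] are kept to identify composites later. *)
Lemma path_ring_change (f g f' g' : {poly K}) :
  admissible f g -> admissible f' g' ->
  exists (phi : khom (path_ring d e f' g') (path_ring d e f g)) k,
  [/\ filtered phi,
      forall x, phi (shift f' g' x) = shift f g (phi x),
      phi (Defs.coord d e f' g' 0) = Defs.coord d e f g 0 * k,
      one_unit (@wt_ge K d e f g) k &
      change_eq (shift f g) d e f g f' g' (Defs.coord d e f g 0) k].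
Proof.
move=> [fm gm fd ge] [f'm g'm f'd g'e].
have hW := path_ring_weighted hde f g.
have r1 : 1 < r := ratio_gt1 hde.
have w1 := wt_ge_coord0 f g.
have [k k1 kE] := change_eq_ex hW r1 fm gm f'm g'm fd ge f'd g'e d0 w1.
have v1 : wt_ge 1 (Defs.coord d e f g 0 * k) by apply: (weighted_mulr hW).
have rel := change_eq_rel hW fm fd w1 (coord_rel hde f g) kE.
have [phi [fphi phiE]] := path_ring_hom_ex v1 rel.
exists phi, k; split; [exact: fphi| |exact: (phiE 0%N)|exact: k1|exact: kE].
apply: (@path_ring_hom_uniq K d e hde f g f' g' (khom_comp phi (shift f' g'))
  (khom_comp (shift f g) phi)) => [X x x0|X x x0|i].
- exact/fphi/completion_at_shift.
- exact/completion_at_shift/fphi.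
exact: etrans (congr1 phi (path_shift_coord f' g' hde i))
  (etrans (phiE i.+1) (congr1 (shift f g) (esym (phiE i)))).
Qed.

Lemma path_ring_iso (f g f' g' : {poly K}) :
  admissible f g -> admissible f' g' ->
  exists (phi : khom (path_ring d e f' g') (path_ring d e f g))
         (psi : khom (path_ring d e f g) (path_ring d e f' g')),
  [/\ cancel psi phi, cancel phi psi &
      forall x, phi (shift f' g' x) = shift f g (phi x)].
Proof.
(* Stated for two arbitrary pairs so as to serve for both composites. *)
have key (f1 g1 f2 g2 : {poly K})
    (u : khom (path_ring d e f2 g2) (path_ring d e f1 g1))
    (v : khom (path_ring d e f1 g1) (path_ring d e f2 g2)) k l :
  admissible f1 g1 -> admissible f2 g2 ->
  filtered u -> filtered v ->
  (forall x, u (shift f2 g2 x) = shift f1 g1 (u x)) ->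
  (forall x, v (shift f1 g1 x) = shift f2 g2 (v x)) ->
  u (Defs.coord d e f2 g2 0) = Defs.coord d e f1 g1 0 * k ->
  v (Defs.coord d e f1 g1 0) = Defs.coord d e f2 g2 0 * l ->
  one_unit (@wt_ge K d e f1 g1) k -> one_unit (@wt_ge K d e f2 g2) l ->
  change_eq (shift f1 g1) d e f1 g1 f2 g2 (Defs.coord d e f1 g1 0) k ->
  change_eq (shift f2 g2) d e f2 g2 f1 g1 (Defs.coord d e f2 g2 0) l ->
  cancel v u.
  move=> [f1m g1m f1d g1e] [f2m g2m f2d g2e] fu fv us vs uw vw k1 l1 kE lE.
  have hW := path_ring_weighted hde f1 g1; have w1 := wt_ge_coord0 f1 g1.
  have r1 : 1 < r := ratio_gt1 hde.
  have ul1 : one_unit (@wt_ge K d e f1 g1) (u l).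
    have -> : one_unit (@wt_ge K d e f1 g1) (u l) = wt_ge 1 (u (l - 1)).
      by rewrite /one_unit rmorphB rmorph1.
    exact: (filtered_wt_ge fu l1).
  (* The composite multiplies [w_0] by [k * u l], a 1-unit solving the equation from the pair to
     itself, of which 1 is the unique such solution. *)
  have kul : k * u l = 1.
    apply: (change_eq_uniq hW r1 f1m g1m f1d g1e d0 w1).
    - exact: (one_unitM hW).
    - exact: (one_unit1 hW).
    - apply: (change_eq_mul hW r1 f2m g2m f2d g2e w1 kE).
      (* Applying [u] to the equation of [l] moves its base point to [u w_0], which [uw] identifies
         with [w_0 * k]. *)
      pose P w := change_eq (shift f1 g1) d e f2 g2 f1 g1 w (u l).
      exact: (eq_ind _ P (change_eq_khom us lE) _ uw).
    - exact: change_eq1.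
  apply: (@path_ring_hom_uniq K d e hde f1 g1 f1 g1 (khom_comp u v) (khom_id _)).
  - by move=> X x x0; apply/fu/fv.
  - by move=> X x x0; exact: x0.
  (* Agreement on [w_0] spreads to all coordinates by shift-equivariance. *)
  elim=> [|i IHi].
    apply: etrans (congr1 u vw) (etrans (rmorphM u _ _) _).
    apply: etrans (congr1 (fun z => z * u l) uw) (etrans (esym (mulrA _ _ _)) _).
    by rewrite kul mulr1.
  rewrite -(path_shift_coord f1 g1 hde i).
  exact: etrans (congr1 u (vs _)) (etrans (us _) (congr1 (shift f1 g1) IHi)).
move=> adm adm'; have [phi [k [fphi phis phiw k1 kE]]] := path_ring_change adm adm'.
have [psi [l [fpsi psis psiw l1 lE]]] := path_ring_change adm' adm.
exists phi, psi; split; last exact: phis.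
- exact: (key _ _ _ _ _ _ _ _ adm adm' fphi fpsi phis psis phiw psiw k1 l1 kE lE).
- exact: (key _ _ _ _ _ _ _ _ adm' adm fpsi fphi psis phis psiw phiw l1 k1 lE kE).
Qed.

End ChangeOfCoordinate.

(** * Passage to spectra *)

Lemma Spec_map_iso (K : fieldType) (A B : kalg K) (phi : khom A B) (psi : khom B A) :
  cancel psi phi -> cancel phi psi -> kmor_iso (Spec_map phi).
Proof.
move=> psiK phiK; exists (Spec_map psi); split; apply: kmor_ext => T x;
  apply: khom_ext => y /=; first by rewrite psiK.
by rewrite phiK.
Qed.

Lemma Spec_map_square (K : fieldType) (A B : kalg K) (phi : khom A B)
    (s : khom B B) (t : khom A A) :
  (forall x, phi (t x) = s (phi x)) ->
  kmor_comp (Spec_map phi) (Spec_map s) = kmor_comp (Spec_map t) (Spec_map phi).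
Proof.
by move=> ts; apply: kmor_ext => T x; apply: khom_ext => y /=; rewrite ts.
Qed.

Theorem theorem3 (R : idomainType) (hR : dedekind_ring R)
    (d e : nat) (hde : (1 <= e < d)%N)
    (hd : (d%:R : R) \is a GRing.unit) (he : (e%:R : R) \is a GRing.unit)
    (f g : {poly R}) (hf : f \is monic) (hg : g \is monic)
    (hfd : size f = d.+1) (hge : size g = e.+1) :
  let fK : {poly {fraction R}} := map_poly (@tofrac R) f in
  let gK : {poly {fraction R}} := map_poly (@tofrac R) g in
  let xd : {poly {fraction R}} := 'X^d in
  let ye : {poly {fraction R}} := 'X^e in
  let sigma := shift_at_infty fK gK hde in
  let tau := shift_at_infty xd ye hde in
  exists Xi : kmor (path_space_at_infty d e fK gK) (path_space_at_infty d e xd ye),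
    kmor_iso Xi /\ kmor_comp Xi sigma = kmor_comp tau Xi.
Proof.
move=> fK gK xd ye sigma tau.
have d0 : (d%:R : {fraction R}) != 0.
  rewrite -(rmorph_nat (@tofrac R)) tofrac_eq0.
  by apply: contraTneq hd => ->; rewrite unitr0.
(* Injectivity keeps the degrees of [f] and [g] over the fraction field. *)
have tofrac_inj : injective (@tofrac R).
  by move=> x y /eqP; rewrite tofrac_eq => /eqP.
have [|| phi [psi [psiK phiK phis]]] :=
  @path_ring_iso _ d e hde d0 fK gK xd ye.
- by split; rewrite ?monic_map // size_map_inj_poly ?rmorph0.
- by split; rewrite ?monicXn // size_polyXn.
exists (Spec_map phi); split; first exact: Spec_map_iso psiK phiK.
exact: Spec_map_square phis.
Qed.
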